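(* Let $0<p\le 1$, let $n\ge 1$ be an integer and let $E$ be a fixed $p$-Banach space. For every $p$-Banach space $X$ there exists an into isomorphism (a bounded linear operator that is an isomorphism onto its closed image) $\rho^n_X: X\to \mathcal N_E^n(X)$, where $\mathcal N^n_E(X)$ is the $p$-Banach space constructed in the context, such that for every element $[\mathfrak Z]\in \mathrm{Ext}^n_{\mathbf{pB}}(E,X)$ it holds that $[\rho_X^n\mathfrak Z]=0$ in $\mathrm{Ext}^n_{\mathbf{pB}}(E,\mathcal N_E^n(X))$.
   Context: $\mathbf{pB}$ is the category of (real) $p$-Banach spaces (complete $p$-normed spaces) and bounded linear operators. A strict short exact sequence $0\to Y\to X\to Z\to 0$ is an exact one in which $Y\to X$ is an embedding with closed range and $X\to Z$ is surjective. For $n\ge1$, a Yoneda $n$-extension of $E$ by $X$ is an exact sequence $0\to X\to Z_1\to Z_2\to\cdots\to Z_n\to E\to 0$ in $\mathbf{pB}$ that splices from $n$ strict short exact sequences. Two $n$-extensions of $E$ by $X$ are equivalent if they are connected by a finite zigzag of morphisms (commuting families of operators) that are the identity on $X$ and on $E$. $\mathrm{Ext}^n_{\mathbf{pB}}(E,X)$ denotes the set of equivalence classes, which is a vector space under the Baer sum. Its zero is the class of $0\to X\to X\oplus_p E\to E\to0$ for $n=1$, and of $0\to X= X\xrightarrow{0}\cdots\xrightarrow{0}E= E\to 0$ (with zero spaces between the second $X$ and the first $E$ if $n>2$) for $n>1$. For an operator $T:X\to Y$, the push-out $T\mathfrak Z$ of $\mathfrak Z: 0\to X\xrightarrow{j}Z_1\to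 Z_2\to\cdots\to E\to0$ is $0\to Y\to PO\to Z_2\to\cdots\to Z_n\to E\to 0$, where $PO=(Y\oplus_p Z_1)/\{(Tx,-jx):x\in X\}$ (for $n=1$: $0\to Y\to PO\to E\to0$). The class $[T\mathfrak Z]$ depends only on $[\mathfrak Z]$. For a family $(X_i)_{i\in I}$ of $p$-Banach spaces, $(\bigoplus_{i\in I}X_i)_p$ is the space of $(x_i)\in\prod_i X_i$ with $\|(x_i)\|=(\sum_i\|x_i\|^p)^{1/p}<\infty$. Construction of $\mathcal N_E^n(X)$: put $A=\mathrm{Ext}^n_{\mathbf{pB}}(E,X)$, and for each $\alpha\in A$ choose an (arbitrary) representative $0\to X\xrightarrow{j_\alpha}Z_{1,\alpha}\to Z_{2,\alpha}\to\cdots\to Z_{n,\alpha}\to E\to0$ of the class $\alpha$ with $\|j_\alpha\|=1$. For $x\in X$ and distinct $\alpha,\alpha'\in A$, let $x_{\alpha,\alpha'}\in(\bigoplus_{\alpha\in A}Z_{1,\alpha})_p$ be the element whose $\alpha$-coordinate is $j_\alpha(x)$, whose $\alpha'$-coordinate is $-j_{\alpha'}(x)$, and whose other coordinates are $0$. Let $X_A$ be the closed linear span of all the $x_{\alpha,\alpha'}$, and set $\mathcal N_E^n(X)=(\bigoplus_{\alpha\in A}Z_{1,\alpha})_p/X_A$.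
   Formalization: The chosen representatives are also required to satisfy c‖x‖ ≤ ‖j_α x‖ for one c>0 and all α (e.g. isometric j_α; such choices are shown to exist), since ‖j_α‖=1 alone does not suffice (p=1, E=X=ℓ_2); for X=0 the condition ‖j_α‖=1, impossible there, is dropped. *)

(* Defs.v *)
From HB Require Import structures.
From mathcomp Require Import all_boot all_order all_algebra.
From mathcomp Require Import all_classical all_reals all_analysis.
From mathcomp Require Import lra.
From Stdlib Require Import Relation_Operators.

Set Implicit Arguments.
Unset Strict Implicit.
Unset Printing Implicit Defensive.

Import Order.TTheory GRing.Theory Num.Theory.
Local Open Scope classical_set_scope.
Local Open Scope ring_scope.

Section NormSequences.
Context {R : realType} {V : zmodType}.
Variable nrm : V -> R.

Definition nrm_cvg (u : nat -> V) (l : V) :=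
  forall e : R, 0 < e -> exists N : nat,
    forall n, (N <= n)%N -> nrm (u n - l) < e.

Definition nrm_cauchy (u : nat -> V) :=
  forall e : R, 0 < e -> exists N : nat,
    forall m n, (N <= m)%N -> (N <= n)%N -> nrm (u m - u n) < e.

Definition nrm_complete :=
  forall u, nrm_cauchy u -> exists l, nrm_cvg u l.

End NormSequences.

Record pBanach (R : realType) (p : R) := PBanach {
  pb_lmod :> lmodType R;
  pnorm : pb_lmod -> R;
  pnorm_ge0 : forall x, 0 <= pnorm x;
  pnorm_eq0 : forall x, pnorm x = 0 -> x = 0;
  pnormZ : forall (a : R) x, pnorm (a *: x) = `|a| * pnorm x;
  pnormD : forall x y, pnorm (x + y) `^ p <= pnorm x `^ p + pnorm y `^ p;
  pnorm_complete : nrm_complete pnorm }.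

Record bop (R : realType) (p : R) (X Y : pBanach p) := BOp {
  bop_lin :> {linear X -> Y};
  bop_bounded : exists C : R, forall x, pnorm (bop_lin x) <= C * pnorm x }.

Section Basics.
Context {R : realType} {p : R}.
Implicit Types X Y Z : pBanach p.

Definition subspace (V : lmodType R) (W : set V) :=
  W 0 /\ forall (a : R) x y, W x -> W y -> W (a *: x + y).

Definition pclosed X (W : set X) :=
  forall (u : nat -> X) (l : X),
    (forall n, W (u n)) -> nrm_cvg (@pnorm _ _ X) u l -> W l.

Definition closed_subspace X (W : set X) := subspace W /\ pclosed W.

Definition closed_span X (S : set X) : set X := smallest (@closed_subspace X) S.

Definition bop_norm X Y (f : bop X Y) : R :=
  sup [set pnorm (f x) | x in [set x | pnorm x <= 1]].

Definition into_isomorphism X Y (f : bop X Y) :=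
  (exists2 c : R, 0 < c & forall x, c * pnorm x <= pnorm (f x)) /\
  pclosed (range f).

Definition strict_ses Y X Z (i : bop Y X) (q : bop X Z) :=
  [/\ into_isomorphism i,
      forall x, q x = 0 <-> exists y, i y = x
    & forall z, exists x, q x = z].

Lemma bop_boundedP X Y (f : bop X Y) :
  exists2 C : R, 0 < C & forall x, pnorm (f x) <= C * pnorm x.
Proof.
have [C hC] := bop_bounded f; exists (`|C| + 1).
  by rewrite ltr_wpDl.
move=> x; apply: (le_trans (hC x)); apply: ler_wpM2r; first exact: pnorm_ge0.
by apply: (le_trans (ler_norm C)); rewrite lerDl.
Qed.

Lemma pnorm0 X : pnorm (0 : X) = 0.
Proof. by rewrite -(scale0r (0 : X)) pnormZ normr0 mul0r. Qed.

Lemma pnormN X (x : X) : pnorm (- x) = pnorm x.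
Proof. by rewrite -scaleN1r pnormZ normrN1 mul1r. Qed.

Lemma pnorm_distC X (x y : X) : pnorm (x - y) = pnorm (y - x).
Proof. by rewrite -opprB pnormN. Qed.

Definition bop_of X Y (f : X -> Y) (lf : linear f)
    (bf : exists C : R, forall x, pnorm (f x) <= C * pnorm x) : bop X Y :=
  let f' := GRing.isLinear.Build R X Y *:%R f lf in
  @BOp _ _ X Y (HB.pack f f') bf.

Fact bop_zero_linear X Y : linear (fun _ : X => 0 : Y).
Proof. by move=> a x y; rewrite scaler0 addr0. Qed.

Fact bop_zero_bounded X Y :
  exists C : R, forall x : X, pnorm (0 : Y) <= C * pnorm x.
Proof. by exists 0 => x; rewrite pnorm0 mul0r. Qed.

Definition bop_zero X Y : bop X Y :=
  bop_of (@bop_zero_linear X Y) (bop_zero_bounded X Y).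

Fact bop_id_linear X : linear (fun x : X => x).
Proof. by []. Qed.

Fact bop_id_bounded X : exists C : R, forall x : X, pnorm x <= C * pnorm x.
Proof. by exists 1 => x; rewrite mul1r. Qed.

Definition bop_id X : bop X X := bop_of (@bop_id_linear X) (bop_id_bounded X).

End Basics.

Section PowerNorm.
Context {R : realType} {p : R}.
Hypothesis hp : 0 < p <= 1.

Let p_gt0 : 0 < p. Proof. by case/andP: hp. Qed.
Let pV_gt0 : 0 < p^-1. Proof. by rewrite invr_gt0. Qed.

Lemma powRK (x : R) : 0 <= x -> (x `^ p) `^ p^-1 = x.
Proof. by move=> x0; rewrite -powRrM mulfV ?gt_eqF// powRr1. Qed.

Lemma powRVK (x : R) : 0 <= x -> (x `^ p^-1) `^ p = x.
Proof. by move=> x0; rewrite -powRrM mulVf ?gt_eqF// powRr1. Qed.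

Lemma ler_powp (x y : R) : 0 <= x -> 0 <= y -> (x `^ p <= y `^ p) = (x <= y).
Proof.
move=> x0 y0; apply/idP/idP => h; last first.
  by apply: ge0_ler_powR => //; exact: ltW.
rewrite -(powRK x0) -(powRK y0).
by apply: ge0_ler_powR; rewrite ?nnegrE ?powR_ge0// ltW.
Qed.

Lemma ltr_powp (x y : R) : 0 <= x -> 0 <= y -> (x `^ p < y `^ p) = (x < y).
Proof. by move=> x0 y0; rewrite !ltNge ler_powp. Qed.

Lemma nrm_complete_powp (V : zmodType) (nrm : V -> R) :
  (forall x, 0 <= nrm x) ->
  nrm_complete (fun x => nrm x `^ p) -> nrm_complete nrm.
Proof.
move=> nrm0 cplt u cu.
have [|l hl] := cplt u.
  move=> e e0; have [|N hN] := cu (e `^ p^-1); first exact: powR_gt0.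
  exists N => m n hm hn; rewrite -[ltRHS](powRVK (ltW e0)) ltr_powp//.
    exact: hN.
  exact: powR_ge0.
exists l => e e0; have [|N hN] := hl (e `^ p); first exact: powR_gt0.
by exists N => n hn; rewrite -ltr_powp ?(ltW e0)//; exact: hN.
Qed.

Definition fnorm (X : pBanach p) (x : X) : R := pnorm x `^ p.

Section Fnorm.
Implicit Types X Y : pBanach p.

Lemma fnorm_ge0 X (x : X) : 0 <= fnorm x. Proof. exact: powR_ge0. Qed.

Lemma fnorm0 X : fnorm (0 : X) = 0.
Proof. by rewrite /fnorm pnorm0 powR0// gt_eqF. Qed.

Lemma fnorm_eq0 X (x : X) : fnorm x = 0 -> x = 0.
Proof. by move=> /powR_eq0_eq0 /pnorm_eq0. Qed.

Lemma fnormZ X a (x : X) : fnorm (a *: x) = `|a| `^ p * fnorm x.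
Proof. by rewrite /fnorm pnormZ powRM// pnorm_ge0. Qed.

Lemma fnormD X (x y : X) : fnorm (x + y) <= fnorm x + fnorm y.
Proof. exact: pnormD. Qed.

Lemma fnormN X (x : X) : fnorm (- x) = fnorm x.
Proof. by rewrite /fnorm pnormN. Qed.

Lemma fnorm_distC X (x y : X) : fnorm (x - y) = fnorm (y - x).
Proof. by rewrite /fnorm pnorm_distC. Qed.

Lemma ler_fnormB X (x y z : X) : fnorm (x - z) <= fnorm (x - y) + fnorm (y - z).
Proof. by rewrite (le_trans _ (fnormD _ _))// addrA subrK. Qed.

Lemma nrm_cvg_fnorm X (u : nat -> X) l :
  nrm_cvg (@pnorm _ _ X) u l <-> nrm_cvg (@fnorm X) u l.
Proof.
split=> h e e0.
  have [|N hN] := h (e `^ p^-1); first exact: powR_gt0.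
  exists N => n hn; rewrite -[ltRHS](powRVK (ltW e0)) ltr_powp ?pnorm_ge0//.
    exact: hN.
  exact: powR_ge0.
have [|N hN] := h (e `^ p); first exact: powR_gt0.
by exists N => n hn; rewrite -ltr_powp ?pnorm_ge0 ?(ltW e0)//; exact: hN.
Qed.

Lemma fnorm_complete X : nrm_complete (@fnorm X).
Proof.
move=> u cu; have [|l hl] := @pnorm_complete _ _ X u.
  move=> e e0; have [|N hN] := cu (e `^ p); first exact: powR_gt0.
  exists N => m n hm hn.
  by rewrite -ltr_powp ?pnorm_ge0 ?(ltW e0)//; exact: hN.
by exists l; apply/nrm_cvg_fnorm.
Qed.


Lemma nrm_cvg_unique X (u : nat -> X) l l' :
  nrm_cvg (@fnorm X) u l -> nrm_cvg (@fnorm X) u l' -> l = l'.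
Proof.
move=> h h'; apply/subr0_eq/fnorm_eq0/eqP; rewrite eq_le fnorm_ge0 andbT.
apply/ler_addgt0Pl => e e0; rewrite addr0.
have [|N hN] := h (e / 2); first by rewrite divr_gt0.
have [|N' hN'] := h' (e / 2); first by rewrite divr_gt0.
rewrite (le_trans (ler_fnormB _ (u (maxn N N')) _))// [leRHS]splitr.
by rewrite lerD// ltW// ?hN' ?leq_maxr// fnorm_distC hN// leq_maxl.
Qed.

Lemma fnorm_bop X Y (f : bop X Y) :
  exists2 C : R, 0 < C & forall x, fnorm (f x) <= C * fnorm x.
Proof.
have [C C0 hC] := bop_boundedP f; exists (C `^ p); first exact: powR_gt0.
move=> x; rewrite -powRM ?pnorm_ge0 ?(ltW C0)//.
by rewrite ler_powp ?pnorm_ge0// mulr_ge0// ?pnorm_ge0// ltW.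
Qed.

Lemma bop_of_fnorm_bounded X Y (f : X -> Y) :
  (exists C : R, forall x, fnorm (f x) <= C * fnorm x) ->
  exists C : R, forall x, pnorm (f x) <= C * pnorm x.
Proof.
move=> [C hC]; exists ((`|C| `^ p^-1)) => x.
rewrite -ler_powp ?pnorm_ge0// ?mulr_ge0 ?powR_ge0 ?pnorm_ge0//.
rewrite powRM ?powR_ge0 ?pnorm_ge0// powRVK// (le_trans (hC x))//.
by rewrite ler_wpM2r ?powR_ge0// ler_norm.
Qed.

Lemma into_isomorphismP X Y (f : bop X Y) :
  into_isomorphism f <->
  exists2 c : R, 0 < c & forall x, c * fnorm x <= fnorm (f x).
Proof.
split=> [[[c c0 hc] _]|[c c0 hc]].
  exists (c `^ p); first exact: powR_gt0.
  move=> x; rewrite -powRM ?pnorm_ge0 ?(ltW c0)//.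
  by rewrite ler_powp ?pnorm_ge0// mulr_ge0// ?pnorm_ge0// ltW.
split.
  exists (c `^ p^-1); first exact: powR_gt0.
  move=> x; rewrite -ler_powp ?pnorm_ge0// ?mulr_ge0 ?powR_ge0 ?pnorm_ge0//.
  by rewrite powRM ?powR_ge0 ?pnorm_ge0// powRVK ?(ltW c0)//; exact: hc.
move=> u l hu /nrm_cvg_fnorm ul.
have /choice[v hv] : forall n, exists x, f x = u n.
  by move=> n; have [x _ <-] := hu n; exists x.
have [|x hx] := @fnorm_complete X v.
  move=> e e0; have [|N hN] := ul (c * e / 2).
    by rewrite divr_gt0// mulr_gt0.
  exists N => m n hm hn; rewrite -(ltr_pM2l c0).
  rewrite (le_lt_trans (hc _))// linearB !hv.
  rewrite (le_lt_trans (ler_fnormB _ l _))// [ltRHS]splitr ltrD//.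
    exact: hN.
  by rewrite fnorm_distC hN.
exists x => //; apply: (@nrm_cvg_unique _ u) => // e e0.
have [C C0 hC] := fnorm_bop f.
have [|N hN] := hx (e / C); first by rewrite divr_gt0.
exists N => n hn; rewrite -hv -linearB (le_lt_trans (hC _))//.
by rewrite mulrC -ltr_pdivlMr// hN.
Qed.

End Fnorm.

End PowerNorm.

Section Zero.
Context {R : realType} (p : R).

Let V0 (x y : 'rV[R]_0) : x = y.
Proof. by rewrite (thinmx0 x) (thinmx0 y). Qed.

Fact pb_zeroZ (a : R) (x : 'rV[R]_0) : (0 : R) = `|a| * 0.
Proof. by rewrite mulr0. Qed.

Fact pb_zeroD (x y : 'rV[R]_0) : (0 : R) `^ p <= 0 `^ p + 0 `^ p.
Proof. by rewrite lerDl powR_ge0. Qed.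

Fact pb_zero_complete : nrm_complete (fun _ : 'rV[R]_0 => 0 : R).
Proof. by move=> u _; exists 0 => e e0; exists 0%N. Qed.

Definition pb_zero : pBanach p :=
  @PBanach _ _ 'rV[R]_0 (fun=> 0) (fun=> lexx 0) (fun x _ => V0 x 0)
    pb_zeroZ pb_zeroD pb_zero_complete.

End Zero.

Section DirectSum.
Context {R : realType} {p : R} (hp : 0 < p <= 1).
Variables Y Z : pBanach p.
Implicit Types x y : (Y * Z)%type.

Let p_gt0 : 0 < p. Proof. by case/andP: hp. Qed.

Definition dsum_norm x : R := (pnorm x.1 `^ p + pnorm x.2 `^ p) `^ p^-1.

Let dsum_powp x : dsum_norm x `^ p = fnorm x.1 + fnorm x.2.
Proof. by rewrite powRVK// addr_ge0// fnorm_ge0. Qed.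

Fact dsum_ge0 x : 0 <= dsum_norm x.
Proof. exact: powR_ge0. Qed.

Fact dsum_eq0 x : dsum_norm x = 0 -> x = 0.
Proof.
move=> /(congr1 (@powR R ^~ p)); rewrite dsum_powp powR0 ?gt_eqF//.
move=> /eqP; rewrite paddr_eq0 ?fnorm_ge0// => /andP[/eqP + /eqP].
by case: x => a b /= /fnorm_eq0 -> /fnorm_eq0 ->.
Qed.

Fact dsumZ (a : R) x : dsum_norm (a *: x) = `|a| * dsum_norm x.
Proof.
apply: (powR_injective p_gt0); rewrite ?nnegrE ?mulr_ge0 ?dsum_ge0//.
by rewrite powRM ?dsum_ge0// !dsum_powp !fnormZ mulrDr.
Qed.

Fact dsumD x y : dsum_norm (x + y) `^ p <= dsum_norm x `^ p + dsum_norm y `^ p.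
Proof. by rewrite !dsum_powp addrACA lerD// fnormD. Qed.

Fact dsum_complete : nrm_complete dsum_norm.
Proof.
apply: (nrm_complete_powp hp) => [x|u cu]; first exact: dsum_ge0.
have [|l hl] := @fnorm_complete _ _ hp Y (fun n => (u n).1).
  move=> e e0; have [N hN] := cu e e0; exists N => m n hm hn.
  by rewrite (le_lt_trans _ (hN m n hm hn))// dsum_powp lerDl fnorm_ge0.
have [|r hr] := @fnorm_complete _ _ hp Z (fun n => (u n).2).
  move=> e e0; have [N hN] := cu e e0; exists N => m n hm hn.
  by rewrite (le_lt_trans _ (hN m n hm hn))// dsum_powp lerDr fnorm_ge0.
exists (l, r) => e e0.
have [|N hN] := hl (e / 2); first by rewrite divr_gt0.
have [|N' hN'] := hr (e / 2); first by rewrite divr_gt0.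
exists (maxn N N') => n; rewrite geq_max => /andP[nN nN'].
by rewrite dsum_powp [ltRHS]splitr ltrD//; [exact: hN|exact: hN'].
Qed.

Definition dsum : pBanach p :=
  @PBanach _ _ (Y * Z)%type dsum_norm dsum_ge0 dsum_eq0 dsumZ dsumD
    dsum_complete.

Lemma fnorm_dsum (x : dsum) : fnorm x = fnorm x.1 + fnorm x.2.
Proof. exact: dsum_powp. Qed.

End DirectSum.

Section Quotient.
Context {R : realType} (V : lmodType R) (W : set V).
Hypothesis sW : subspace W.

Let W0 : W 0. Proof. by case: sW. Qed.
Let WZ a x : W x -> W (a *: x).
Proof. by move=> wx; rewrite -[_ *: _]addr0; apply: (sW.2 a). Qed.
Let WD x y : W x -> W y -> W (x + y).
Proof. by move=> wx wy; rewrite -[x]scale1r; apply: sW.2. Qed.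
Let WN x : W x -> W (- x).
Proof. by move=> wx; rewrite -scaleN1r; exact: WZ. Qed.

Definition coset_rel : rel V := fun x y => `[< W (x - y) >].

Fact coset_rel_equiv : equiv_class_of coset_rel.
Proof.
split=> [x|x y|y x z].
- by apply/asboolP; rewrite subrr.
- by apply/asboolP/asboolP => /WN; rewrite opprB.
- by move=> /asboolP h1 /asboolP h2; apply/asboolP; rewrite -(subrK y x) -addrA; exact: WD.
Qed.

Canonical coset_equiv := EquivRelPack coset_rel_equiv.

Definition quot := {eq_quot coset_equiv}%qT.
HB.instance Definition _ : EqQuotient V coset_equiv quot :=
  EqQuotient.on quot.
HB.instance Definition _ := Choice.on quot.

Lemma quot_piP x y : (\pi_quot x = \pi_quot y)%qT <-> W (x - y).
Proof.
by split=> [/eqmodP /asboolP|h]; [|apply/eqmodP/asboolP].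
Qed.

Lemma quot_repr x : W (repr (\pi_quot x)%qT - x).
Proof. by apply/quot_piP; rewrite reprK. Qed.

Definition quot_add (a b : quot) : quot := (\pi_quot (repr a + repr b))%qT.
Definition quot_opp (a : quot) : quot := (\pi_quot (- repr a))%qT.
Definition quot_scale (c : R) (a : quot) : quot := (\pi_quot (c *: repr a))%qT.

Let piD x y : (\pi_quot (x + y) = quot_add (\pi_quot x) (\pi_quot y))%qT.
Proof.
apply/esym/quot_piP; rewrite opprD addrACA.
by apply: WD; exact: quot_repr.
Qed.

Let piN x : (\pi_quot (- x) = quot_opp (\pi_quot x))%qT.
Proof. by apply/esym/quot_piP; rewrite -opprD; apply: WN; exact: quot_repr. Qed.

Let piZ c x : (\pi_quot (c *: x) = quot_scale c (\pi_quot x))%qT.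
Proof. by apply/esym/quot_piP; rewrite -scalerBr; apply: WZ; exact: quot_repr. Qed.

Fact quot_addA : associative quot_add.
Proof.
by move=> a b c; elim/quotW: a => x; elim/quotW: b => y; elim/quotW: c => z;
rewrite -(piD y z) -(piD x y) -2!(piD) addrA.
Qed.
Fact quot_addC : commutative quot_add.
Proof. by move=> a b; elim/quotW: a => x; elim/quotW: b => y; rewrite -!piD addrC. Qed.
Fact quot_add0 : left_id (\pi_quot 0)%qT quot_add.
Proof. by move=> a; elim/quotW: a => x; rewrite -piD add0r. Qed.
Fact quot_addN : left_inverse (\pi_quot 0)%qT quot_opp quot_add.
Proof. by move=> a; elim/quotW: a => x; rewrite -(piN x) -piD addNr. Qed.

HB.instance Definition _ :=
  GRing.isZmodule.Build quot quot_addA quot_addC quot_add0 quot_addN.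

Fact quot_scaleA a b v : quot_scale a (quot_scale b v) = quot_scale (a * b) v.
Proof. by elim/quotW: v => x; rewrite -(piZ b x) -!piZ scalerA. Qed.
Fact quot_scale1 : left_id 1 quot_scale.
Proof. by move=> a; elim/quotW: a => x; rewrite -!piZ scale1r. Qed.
Fact quot_scaleDr : right_distributive quot_scale +%R.
Proof.
move=> a b c; elim/quotW: b => x; elim/quotW: c => y.
by rewrite -[_ + _](piD x y) -(piZ a x) -(piZ a y) -piZ scalerDr piD.
Qed.
Fact quot_scaleDl v : {morph quot_scale^~ v : a b / a + b}.
Proof. by move=> a b; elim/quotW: v => x; rewrite -!piZ scalerDl piD. Qed.

HB.instance Definition _ :=
  GRing.Zmodule_isLmodule.Build R quot quot_scaleA quot_scale1 quot_scaleDr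
    quot_scaleDl.

Definition quot_pi (x : V) : quot := (\pi_quot x)%qT.

Lemma quot_pi_linear : linear quot_pi.
Proof. by move=> a x y; rewrite /quot_pi piD piZ. Qed.

Lemma quot_pi_surj (a : quot) : exists x, quot_pi x = a.
Proof. by elim/quotW: a => x; exists x. Qed.

Lemma quot_pi_eq x y : quot_pi x = quot_pi y <-> W (x - y).
Proof. exact: quot_piP. Qed.

End Quotient.

Section QuotientNorm.
Context {R : realType} {p : R} (hp : 0 < p <= 1) (V : pBanach p) (W : set V).
Hypothesis cW : closed_subspace W.

Let p_gt0 : 0 < p. Proof. by case/andP: hp. Qed.
Local Notation Q := (quot cW.1).
Local Notation pi := (quot_pi cW.1).

Definition quot_norm (a : Q) : R := inf [set pnorm x | x in [set x | pi x = a]].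

Let piD x y : pi (x + y) = pi x + pi y.
Proof. by rewrite -[x]scale1r quot_pi_linear !scale1r. Qed.
Let piZ c x : pi (c *: x) = c *: pi x.
Proof.
have pi0 : pi 0 = 0.
  by have := piD 0 0; rewrite addr0 -[LHS]addr0 => /addrI.
by rewrite -[c *: x]addr0 quot_pi_linear pi0 addr0.
Qed.
Let piB x y : pi (x - y) = pi x - pi y.
Proof. by rewrite piD -scaleN1r piZ scaleN1r. Qed.

Let S_ne a : [set pnorm x | x in [set x | pi x = a]] !=set0.
Proof. by have [x xa] := quot_pi_surj a; exists (pnorm x), x. Qed.

Let quot_norm_le x : quot_norm (pi x) <= pnorm x.
Proof.
apply: ge_inf; last by exists x.
by exists 0 => _ [y _ <-]; exact: pnorm_ge0.
Qed.

Fact quot_norm_ge0 a : 0 <= quot_norm a.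
Proof. by apply: lb_le_inf => // _ [x _ <-]; exact: pnorm_ge0. Qed.

Lemma quot_fnorm_le x : quot_norm (pi x) `^ p <= fnorm x.
Proof. by rewrite ler_powp ?quot_norm_ge0 ?pnorm_ge0. Qed.

Lemma quot_fnorm_lift a e : 0 < e ->
  exists2 x, pi x = a & fnorm x < quot_norm a `^ p + e.
Proof.
move=> e0; have ne0 : 0 <= quot_norm a `^ p + e by rewrite addr_ge0 ?powR_ge0// ltW.
have [|_ [x xa <-] xlt] := @inf_lt _ _ ((quot_norm a `^ p + e) `^ p^-1) (S_ne a).
  rewrite -(@ltr_powp _ _ hp) ?powR_ge0 ?quot_norm_ge0// powRVK//.
  by rewrite ltrDl.
by exists x => //; rewrite -(powRVK hp ne0) ltr_powp ?pnorm_ge0 ?powR_ge0.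
Qed.

Fact quot_norm_eq0 a : quot_norm a = 0 -> a = 0.
Proof.
have [x <-] := quot_pi_surj a => x0.
have /choice[y hy] : forall n : nat,
    exists y, pi y = pi x /\ fnorm y < n.+1%:R^-1.
  move=> n; have [|y yx] := @quot_fnorm_lift (pi x) n.+1%:R^-1.
    by rewrite invr_gt0.
  by rewrite x0 powR0 ?gt_eqF// add0r => ylt; exists y.
suff Wx : W x by rewrite -(subrr (pi 0)) -piB subr0; apply/quot_pi_eq; rewrite subr0.
apply: (cW.2 (fun n => x - y n)).
  by move=> n; apply/(quot_pi_eq cW.1); rewrite (hy n).1.
apply/(nrm_cvg_fnorm hp) => e e0.
exists (Num.bound e^-1) => n hn.
rewrite addrAC subrr add0r fnormN (lt_trans (hy n).2)//.
rewrite invf_plt ?posrE// (lt_le_trans (archi_boundP _)) ?invr_ge0 ?(ltW e0)//.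
by rewrite ler_nat (leq_trans hn).
Qed.

Let quot_normZ_le c a : quot_norm (c *: a) <= `|c| * quot_norm a.
Proof.
have [->|c0] := eqVneq c 0.
  have [x <-] := quot_pi_surj a.
  by rewrite -piZ scale0r normr0 mul0r -(@pnorm0 _ _ V).
rewrite -ler_pdivrMl ?normr_gt0//; apply: lb_le_inf => // _ [x <- <-].
by rewrite ler_pdivrMl ?normr_gt0// -pnormZ -piZ.
Qed.

Fact quot_normZ c a : quot_norm (c *: a) = `|c| * quot_norm a.
Proof.
apply/eqP; rewrite eq_le quot_normZ_le/=.
have [->|c0] := eqVneq c 0; first by rewrite normr0 mul0r quot_norm_ge0.
rewrite -ler_pdivlMl ?normr_gt0// -normfV -[in leLHS](scale1r a) -(mulVf c0).
by rewrite -scalerA quot_normZ_le.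
Qed.

Fact quot_normD a b :
  quot_norm (a + b) `^ p <= quot_norm a `^ p + quot_norm b `^ p.
Proof.
apply/ler_addgt0Pl => e e0.
have [|x xa hx] := @quot_fnorm_lift a (e / 2); first by rewrite divr_gt0.
have [|y yb hy] := @quot_fnorm_lift b (e / 2); first by rewrite divr_gt0.
rewrite -{1}xa -{1}yb -piD (le_trans (quot_fnorm_le _))//.
rewrite (le_trans (fnormD _ _))// (le_trans (lerD (ltW hx) (ltW hy)))//.
by rewrite addrACA -splitr addrC.
Qed.

Fact quot_norm_complete : nrm_complete quot_norm.
Proof.
apply: (nrm_complete_powp hp) => [a|u cu]; first exact: quot_norm_ge0.
pose h (k : nat) : R := 2^-1 ^+ k.
have h0 k : 0 < h k by rewrite exprn_gt0// invr_gt0.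
have hS k : h k.+1 = h k / 2 by rewrite /h exprS mulrC.
have hlt e : 0 < e -> exists k, forall m, (k <= m)%N -> h m < e.
  move=> e0; exists (Num.bound e^-1) => m hm.
  rewrite /h exprVn invf_plt ?posrE ?exprn_gt0//; exact: upper_nthrootP.
have /choice[N hN] : forall k, exists N, forall m n, (N <= m)%N -> (N <= n)%N ->
    quot_norm (u m - u n) `^ p < h k.
  by move=> k; exact: cu.
pose M k := (\sum_(i < k.+1) N i)%N.
have NM k : (N k <= M k)%N by rewrite /M big_ord_recr/= leq_addl.
have MM k : (N k <= M k.+1)%N.
  by rewrite (leq_trans (NM k))// /M [leqRHS]big_ord_recr leq_addr.
have /choice[g hg] : forall kz : nat * V, exists z', pi kz.2 = u (M kz.1) ->
    pi z' = u (M kz.1.+1) /\ fnorm (z' - kz.2) < h kz.1.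
  move=> [k z] /=; have [zk|] := pselect (pi z = u (M k)); last by exists 0.
  have [|x xE hx] := @quot_fnorm_lift (u (M k.+1) - u (M k))
    (h k - quot_norm (u (M k.+1) - u (M k)) `^ p).
    by rewrite subr_gt0 hN.
  exists (x + z) => _; rewrite piD xE zk subrK addrK; split => //.
  by move: hx; rewrite addrC subrK.
have [z0 hz0] := quot_pi_surj (u (M 0)).
pose z := fix z k := if k is k'.+1 then g (k', z k') else z0.
have zM k : pi (z k) = u (M k).
  by elim: k => //= k IH; exact: (hg (k, z k) IH).1.
have zS k : fnorm (z k.+1 - z k) < h k by exact: (hg (k, z k) (zM k)).2.
have zh k m : fnorm (z (m + k)%N - z k) <= 2 * h k - 2 * h (m + k)%N.
  elim: m => [|m IH]; first by rewrite add0n !subrr fnorm0.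
  rewrite addSn (le_trans (ler_fnormB _ (z (m + k)%N) _))//.
  rewrite (le_trans (lerD (ltW (zS _)) IH))// hS.
  by lra.
have [|l hl] := @fnorm_complete _ _ hp V z.
  move=> e e0; have [|k hk] := hlt (e / 4); first by rewrite divr_gt0.
  have ltk m : (k <= m)%N -> fnorm (z m - z k) < e / 2.
    move=> km; rewrite -(subnK km) (le_lt_trans (zh _ _))//.
    rewrite (@le_lt_trans _ _ (2 * h k))//.
      by rewrite gerBl mulr_ge0// ltW.
    rewrite -ltr_pdivlMl// mulrC -mulrA -invfM -natrM; exact: hk.
  exists k => m n km kn.
  rewrite (le_lt_trans (ler_fnormB _ (z k) _))// [ltRHS]splitr ltrD ?ltk//.
  by rewrite fnorm_distC ltk.
exists (pi l) => e e0.
have [|k hk] := hlt (e / 2); first by rewrite divr_gt0.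
have [|k' hk'] := hl (e / 2); first by rewrite divr_gt0.
pose K := maxn k k'.
exists (N K) => n hn.
have -> : u n - pi l = (u n - u (M K)) + pi (z K - l) by rewrite piB zM addrA subrK.
rewrite (le_lt_trans (quot_normD _ _))// [ltRHS]splitr ltrD//.
  by rewrite (lt_trans (hN K _ _ hn (NM K)))// hk// leq_maxl.
by rewrite (le_lt_trans (quot_fnorm_le _))// hk'// leq_maxr.
Qed.

Definition pb_quot : pBanach p :=
  @PBanach _ _ Q quot_norm quot_norm_ge0 quot_norm_eq0 quot_normZ quot_normD
    quot_norm_complete.

End QuotientNorm.

Section DependentProduct.
Context {R : realType} {I : Type} (X : I -> lmodType R).

Definition dprod := forall i, X i.
HB.instance Definition _ := Choice.on dprod.

Implicit Types x y : dprod.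
Let add x y : dprod := fun i => x i + y i.
Let opp x : dprod := fun i => - x i.
Let scale (a : R) x : dprod := fun i => a *: x i.
Let addA : associative add.
Proof. by move=> x y z; apply: functional_extensionality_dep => i; exact: addrA. Qed.
Let addC : commutative add.
Proof. by move=> x y; apply: functional_extensionality_dep => i; exact: addrC. Qed.
Let add0 : left_id (fun=> 0) add.
Proof. by move=> x; apply: functional_extensionality_dep => i; exact: add0r. Qed.
Let addN : left_inverse (fun=> 0) opp add.
Proof. by move=> x; apply: functional_extensionality_dep => i; exact: addNr. Qed.
HB.instance Definition _ := GRing.isZmodule.Build dprod addA addC add0 addN.

Let scaleA a b x : scale a (scale b x) = scale (a * b) x.
Proof. by apply: functional_extensionality_dep => i; exact: scalerA. Qed.
Let scale1 : left_id 1 scale.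
Proof. by move=> x; apply: functional_extensionality_dep => i; exact: scale1r. Qed.
Let scaleDr : right_distributive scale +%R.
Proof. by move=> a x y; apply: functional_extensionality_dep => i; exact: scalerDr. Qed.
Let scaleDl x : {morph scale^~ x : a b / a + b}.
Proof. by move=> a b; apply: functional_extensionality_dep => i; exact: scalerDl. Qed.
HB.instance Definition _ :=
  GRing.Zmodule_isLmodule.Build R dprod scaleA scale1 scaleDr scaleDl.

End DependentProduct.

(* The unused argument makes hp recoverable by unification, so that the module
   structure below can be attached to this predicate. *)
Definition lp_pred (R : realType) (p : R) of 0 < p <= 1 :=
  fun (I : choiceType) (X : I -> pBanach p) (x : dprod X) =>
    `[< (\esum_(i in [set: I]) (pnorm (x i) `^ p)%:E < +oo)%E >].

Section LpSum.
Context {R : realType} {p : R} (hp : 0 < p <= 1) {I : choiceType}.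
Variable X : I -> pBanach p.
Implicit Types x y : dprod X.

Let p_gt0 : 0 < p. Proof. by case/andP: hp. Qed.
Local Notation es x := (\esum_(i in [set: I]) (pnorm (x i) `^ p)%:E).

Let es_ge0 x : (0 <= es x)%E.
Proof. by apply: esum_ge0 => i _; rewrite lee_fin powR_ge0. Qed.

Let es_leP x (M : R) :
  (forall s : seq I, uniq s -> \sum_(i <- s) fnorm (x i) <= M) ->
  (es x <= M%:E)%E.
Proof.
move=> h; apply: ge_ereal_sup => _ [A [finA _] <-].
rewrite fsbig_finite//= sumEFin lee_fin; exact: h.
Qed.

Let es_ge x (s : seq I) : uniq s -> ((\sum_(i <- s) fnorm (x i))%:E <= es x)%E.
Proof.
move=> us; apply: esum_ge; exists [set` s]; first by split => //; exact: finite_seq.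
by rewrite -fsbig_seq//= sumEFin.
Qed.

Let lpP x : reflect (exists M : R, (es x <= M%:E)%E) (lp_pred hp x).
Proof.
apply: (iffP (asboolP _)) => [h|[M hM]]; last by rewrite (le_lt_trans hM) ?ltry.
by exists (fine (es x)); rewrite fineK// ge0_fin_numE.
Qed.

Let esD x y : (es (x + y) <= es x + es y)%E.
Proof.
rewrite -esumD; try by move=> i _; rewrite lee_fin powR_ge0.
by apply: le_esum => i _; rewrite -EFinD lee_fin pnormD.
Qed.

Let lp_submod : submod_closed (lp_pred hp (X := X)).
Proof.
split=> [|a x y /lpP[M hM] /lpP[M' hM']]; apply/lpP.
  exists 0; apply: es_leP => s _.
  by rewrite big1// => i _; exact: (fnorm0 hp).
exists (`|a| `^ p * M + M'); rewrite EFinD (le_trans (esD _ _))// leeD//.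
apply: es_leP => s us; under eq_bigr do rewrite [fnorm _]fnormZ.
rewrite -mulr_sumr ler_wpM2l ?powR_ge0// -lee_fin.
exact: (le_trans (es_ge x us)).
Qed.

HB.instance Definition _ := GRing.isSubmodClosed.Build R (dprod X)
  (lp_pred hp (X := X)) lp_submod.

Record lp_type := LpType { lp_val : dprod X; _ : lp_pred hp lp_val }.
HB.instance Definition _ := [isSub for lp_val].
HB.instance Definition _ := [Choice of lp_type by <:].
HB.instance Definition _ := [SubChoice_isSubLmodule of lp_type by <:].

Definition lp_norm (x : lp_type) : R :=
  fine (\esum_(i in [set: I]) (pnorm (lp_val x i) `^ p)%:E) `^ p^-1.

Let es_fin (x : lp_type) : es (lp_val x) \is a fin_num.
Proof. by case: x => x /= /asboolP; rewrite ge0_fin_numE. Qed.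

Let lp_powp (x : lp_type) : lp_norm x `^ p = fine (es (lp_val x)).
Proof. by rewrite powRVK// fine_ge0. Qed.

Lemma lp_powp_le (x : lp_type) (M : R) :
  (forall s : seq I, uniq s -> \sum_(i <- s) fnorm (lp_val x i) <= M) ->
  lp_norm x `^ p <= M.
Proof. by move=> /es_leP h; rewrite lp_powp -lee_fin fineK. Qed.

Lemma lp_powp_ge (x : lp_type) (s : seq I) : uniq s ->
  \sum_(i <- s) fnorm (lp_val x i) <= lp_norm x `^ p.
Proof. by move=> us; rewrite lp_powp -lee_fin fineK// es_ge. Qed.

Lemma lp_coord_le (x : lp_type) i : fnorm (lp_val x i) <= lp_norm x `^ p.
Proof. by have := @lp_powp_ge x [:: i] isT; rewrite big_seq1. Qed.

Fact lp_norm_ge0 (x : lp_type) : 0 <= lp_norm x.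
Proof. exact: powR_ge0. Qed.

Fact lp_norm_eq0 (x : lp_type) : lp_norm x = 0 -> x = 0.
Proof.
move=> x0; apply: val_inj; apply: functional_extensionality_dep => i /=.
apply: (@fnorm_eq0 _ p); apply/eqP; rewrite eq_le fnorm_ge0 andbT.
by rewrite (le_trans (lp_coord_le _ _))// x0 powR0// gt_eqF.
Qed.

Let lp_normZ_le a (x : lp_type) : lp_norm (a *: x) <= `|a| * lp_norm x.
Proof.
rewrite -(@ler_powp _ _ hp) ?mulr_ge0 ?powR_ge0// powRM ?powR_ge0//.
apply: lp_powp_le => s us; under eq_bigr do rewrite [fnorm _]fnormZ.
by rewrite -mulr_sumr ler_wpM2l ?powR_ge0// lp_powp_ge.
Qed.

Fact lp_normZ a (x : lp_type) : lp_norm (a *: x) = `|a| * lp_norm x.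
Proof.
apply/eqP; rewrite eq_le lp_normZ_le/=.
have [->|a0] := eqVneq a 0; first by rewrite normr0 mul0r lp_norm_ge0.
rewrite -ler_pdivlMl ?normr_gt0// -normfV -[in leLHS](scale1r x) -(mulVf a0).
by rewrite -scalerA lp_normZ_le.
Qed.

Fact lp_normD (x y : lp_type) : lp_norm (x + y) `^ p <= lp_norm x `^ p + lp_norm y `^ p.
Proof.
apply: lp_powp_le => s us.
rewrite (le_trans _ (lerD (lp_powp_ge x us) (lp_powp_ge y us)))//.
by rewrite -big_split/= ler_sum// => i _; exact: fnormD.
Qed.

Fact lp_norm_complete : nrm_complete lp_norm.
Proof.
apply: (nrm_complete_powp hp) => [x|u cu]; first exact: lp_norm_ge0.
have coord i : exists l : X i, nrm_cvg (@fnorm _ _ (X i)) (fun n => lp_val (u n) i) l.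
  apply: (fnorm_complete hp) => e e0; have [N hN] := cu e e0; exists N => m n hm hn.
  exact: le_lt_trans (lp_coord_le (u m - u n) i) (hN m n hm hn).
pose l : dprod X := fun i => projT1 (cid (coord i)).
have hl i := projT2 (cid (coord i)).
have lim_sum (s : seq I) e : 0 < e -> exists N, forall n, (N <= n)%N ->
    \sum_(i <- s) fnorm (lp_val (u n) i - l i) <= e.
  elim: s e => [|i s IH] e e0; first by exists 0%N => n _; rewrite big_nil ltW.
  have [|N hN] := IH (e / 2); first by rewrite divr_gt0.
  have [|N' hN'] := hl i (e / 2); first by rewrite divr_gt0.
  exists (maxn N N') => n; rewrite geq_max => /andP[nN nN'].
  by rewrite big_cons [leRHS]splitr lerD ?hN// ltW// hN'.
have key e : 0 < e -> exists N, forall n, (N <= n)%N -> forall s, uniq s ->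
    \sum_(i <- s) fnorm (lp_val (u n) i - l i) <= e.
  move=> e0; have [|N hN] := cu (e / 2); first by rewrite divr_gt0.
  exists N => n hn s us.
  have [|N' hN'] := lim_sum s (e / 2); first by rewrite divr_gt0.
  pose m := maxn N N'.
  rewrite [leRHS]splitr.
  rewrite (le_trans _ (lerD (ltW (hN n m hn (leq_maxl _ _)))
    (hN' m (leq_maxr _ _))))//.
  rewrite (le_trans _ (lerD (lp_powp_ge _ us) (lexx _)))//.
  by rewrite -big_split/= ler_sum// => i _; exact: ler_fnormB.
have lmem : lp_pred hp l.
  have [N hN] := key 1 ltr01.
  have dmem : lp_pred hp (lp_val (u N) - l : dprod X).
    by apply/lpP; exists 1; apply: es_leP => s us; exact: hN.
  have umem : lp_val (u N) \in lp_pred hp (X := X) by case: (u N).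
  have := rpredB umem (dmem : _ \in lp_pred hp (X := X)).
  by rewrite subKr.
exists (LpType lmem) => e e0.
have [|N hN] := key (e / 2); first by rewrite divr_gt0.
exists N => n hn; apply: (@le_lt_trans _ _ (e / 2)).
  by apply: lp_powp_le => s us; exact: hN.
by rewrite ltr_pdivrMr// mulr_natr mulr2n ltrDr.
Qed.

Definition lp_sum : pBanach p :=
  @PBanach _ _ lp_type lp_norm lp_norm_ge0 lp_norm_eq0 lp_normZ lp_normD
    lp_norm_complete.

End LpSum.

Section Pushout.
Context {R : realType} {p : R} (hp : 0 < p <= 1).
Implicit Types X Y Z W : pBanach p.

Lemma closed_span_closed X (S : set X) : closed_subspace (closed_span S).
Proof.
split; first split.
- by move=> M [[[]]].
- move=> a x y hx hy M hM; have := (hM.1.1.2 a x y).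
  by apply; [exact: hx|exact: hy].
- by move=> u l hu ul M hM; apply: (hM.1.2 u) => // n; exact: hu.
Qed.

Lemma bop_cvg X Y (f : bop X Y) (u : nat -> X) (l : X) :
  nrm_cvg (@fnorm _ _ X) u l -> nrm_cvg (@fnorm _ _ Y) (f \o u) (f l).
Proof.
move=> ul e e0; have [C C0 hC] := fnorm_bop hp f.
have [|N hN] := ul (e / C); first by rewrite divr_gt0.
exists N => n hn; rewrite /= -linearB (le_lt_trans (hC _))//.
by rewrite mulrC -ltr_pdivlMr// hN.
Qed.

Section Def.
Variables (X Y Z : pBanach p) (T : bop X Y) (j : bop X Z).
Hypothesis hj : into_isomorphism j.

Definition po_graph : set (dsum hp Y Z) := [set (T x, - j x) | x in [set: X]].

Fact po_graph_closed : closed_subspace po_graph.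
Proof.
have [c c0 hc] := (into_isomorphismP hp j).1 hj.
split; first split.
- by exists 0 => //; rewrite !linear0.
- move=> a _ _ [x _ <-] [y _ <-]; exists (a *: x + y) => //.
  by rewrite !linearP.
move=> u l hu /(nrm_cvg_fnorm hp) ul.
have /choice[v hv] : forall n, exists x, (T x, - j x) = u n.
  by move=> n; have [x _ <-] := hu n; exists x.
have u1 : nrm_cvg (@fnorm _ _ Y) (T \o v) l.1.
  move=> e e0; have [N hN] := ul e e0; exists N => n /hN.
  by apply: le_lt_trans; rewrite fnorm_dsum -hv lerDl fnorm_ge0.
have u2 : nrm_cvg (@fnorm _ _ Z) (j \o v) (- l.2).
  move=> e e0; have [N hN] := ul e e0; exists N => n /hN.
  apply: le_lt_trans; rewrite fnorm_dsum -hv.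
  have -> : (j \o v) n - - l.2 = - (- j (v n) - l.2) by rewrite opprD !opprK.
  by rewrite fnormN lerDr fnorm_ge0.
have [|x hx] := @fnorm_complete _ _ hp X v.
  move=> e e0; have [|N hN] := u2 (c * e / 2).
    by rewrite divr_gt0// mulr_gt0.
  exists N => m n hm hn; rewrite -(ltr_pM2l c0).
  rewrite (le_lt_trans (hc _))// linearB.
  rewrite (le_lt_trans (ler_fnormB _ (- l.2) _))// [ltRHS]splitr ltrD//.
    exact: hN.
  by rewrite fnorm_distC; exact: hN.
exists x => //; rewrite [RHS]surjective_pairing; congr pair.
  exact: (nrm_cvg_unique (bop_cvg T hx) u1).
rewrite -[RHS]opprK; congr (- _).
exact: (nrm_cvg_unique (bop_cvg j hx) u2).
Qed.

Definition po_space : pBanach p := pb_quot hp po_graph_closed.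

Definition po_pi (y : Y) (z : Z) : po_space := quot_pi po_graph_closed.1 (y, z).

Fact po_in_linear : linear (fun y => po_pi y 0).
Proof.
move=> a x y; rewrite /po_pi -quot_pi_linear; congr quot_pi.
by congr pair => /=; rewrite ?scaler0 ?addr0.
Qed.

Fact po_in_bounded : exists C : R, forall y, pnorm (po_pi y 0) <= C * pnorm y.
Proof.
apply: (bop_of_fnorm_bounded hp); exists 1 => y; rewrite mul1r.
rewrite (le_trans (quot_fnorm_le hp po_graph_closed _))// fnorm_dsum/=.
by rewrite fnorm0// addr0.
Qed.

Definition po_in : bop Y po_space := bop_of po_in_linear po_in_bounded.

Lemma po_pi_eq y z y' z' : po_pi y z = po_pi y' z' <->
  exists x, T x = y - y' /\ j x = z' - z.
Proof.
split=> [/quot_pi_eq[x _ []]|[x [Tx jx]]].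
  by move=> Tx /eqP; rewrite eqr_oppLR opprB => /eqP jx; exists x.
by apply/quot_pi_eq; exists x => //; rewrite Tx jx opprB.
Qed.

Lemma po_surj (a : po_space) : exists y z, po_pi y z = a.
Proof. by have [[y z] <-] := quot_pi_surj a; exists y, z. Qed.

Section Desc.
Variables (W : pBanach p) (f : bop Z W).

Definition po_desc_fun (a : po_space) : W :=
  f (repr (a : quot po_graph_closed.1)).2.

Hypothesis hf : forall x, f (j x) = 0.

Lemma po_desc_funE y z : po_desc_fun (po_pi y z) = f z.
Proof.
have := quot_repr po_graph_closed.1 (y, z); rewrite /po_desc_fun.
rewrite -/(quot_pi po_graph_closed.1 (y, z)) -/(po_pi y z).
move: (repr _) => w [x _ [_ /(congr1 f)]].
rewrite linearN hf oppr0 linearB => /esym/eqP.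
by rewrite subr_eq0 => /eqP.
Qed.

Fact po_desc_linear : linear po_desc_fun.
Proof.
move=> a u v; have [y [z <-]] := po_surj u; have [y' [z' <-]] := po_surj v.
by rewrite -quot_pi_linear po_desc_funE !po_desc_funE linearP.
Qed.

Fact po_desc_bounded :
  exists C : R, forall a, pnorm (po_desc_fun a) <= C * pnorm a.
Proof.
have [C C0 hC] := fnorm_bop hp f.
apply: (bop_of_fnorm_bounded hp); exists C => a.
rewrite -ler_pdivrMl//; apply/ler_addgt0Pr => e e0.
have [[y z] <- yz] := quot_fnorm_lift hp (cW := po_graph_closed) a e0.
rewrite (le_trans _ (ltW yz))// po_desc_funE ler_pdivrMl//.
by rewrite (le_trans (hC _))// ler_pM2l// fnorm_dsum lerDr fnorm_ge0.
Qed.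

End Desc.

(* The operator (y, z) |-> f z induced on the push-out; 0 if f \o j <> 0, in
   which case there is no such operator. *)
Definition po_desc (W : pBanach p) (f : bop Z W) : bop po_space W :=
  if pselect (forall x, f (j x) = 0) is left hf
  then bop_of (po_desc_linear hf) (po_desc_bounded hf) else bop_zero _ _.

Lemma po_descE W (f : bop Z W) : (forall x, f (j x) = 0) ->
  forall y z, po_desc f (po_pi y z) = f z.
Proof.
by rewrite /po_desc; case: pselect => // hf _ y z; exact: po_desc_funE.
Qed.

Lemma po_in_into : into_isomorphism po_in.
Proof.
have [c c0 hc] := (into_isomorphismP hp j).1 hj.
have [C C0 hC] := fnorm_bop hp T.
pose M := 1 + C / c.
have M0 : 0 < M by rewrite addr_gt0// divr_gt0.
apply/(into_isomorphismP hp); exists M^-1; first by rewrite invr_gt0.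
move=> y; rewrite ler_pdivrMl//.
rewrite -ler_pdivrMl//; apply/ler_addgt0Pr => e e0.
have [[y' z'] yy' lt] :=
  quot_fnorm_lift hp (cW := po_graph_closed) (po_in y) e0.
rewrite (le_trans _ (ltW lt))// ler_pdivrMl// fnorm_dsum/=.
have [x [Tx jx]] := (po_pi_eq _ _ _ _).1 yy'.
have -> : y = y' - T x by rewrite Tx opprB addrC subrK.
rewrite (le_trans (fnormD _ _))// fnormN mulrDr lerD//.
  by rewrite ler_peMl ?fnorm_ge0// lerDl divr_ge0// ltW.
have -> : z' = - j x by rewrite jx sub0r opprK.
rewrite fnormN (le_trans (hC _))// (@le_trans _ _ (C / c * fnorm (j x)))//.
  by rewrite -mulrA ler_pM2l// ler_pdivlMl.
by rewrite ler_wpM2r ?fnorm_ge0// lerDr.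
Qed.

Lemma po_strict_ses (E : pBanach p) (q : bop Z E) :
  strict_ses j q -> strict_ses po_in (po_desc q).
Proof.
move=> [_ ex sj]; have qj x : q (j x) = 0 by apply/ex; exists x.
split; first exact: po_in_into.
  move=> a; have [y [z <-]] := po_surj a; rewrite po_descE//; split.
    move=> /ex[x <-]; exists (y + T x); apply/po_pi_eq; exists x.
    by rewrite addrAC subrr add0r subr0.
  by move=> [y' /po_pi_eq[x [_ jx]]]; apply/ex; exists x; rewrite jx subr0.
by move=> e; have [z <-] := sj e; exists (po_pi 0 z); rewrite po_descE.
Qed.

End Def.
End Pushout.

Section YonedaExtensions.
Context {R : realType} {p : R}.
Implicit Types E X Y : pBanach p.

(* The sequence X -> Z 1 -> ... -> Z n -> E is obtained by splicing the n strict
   short exact sequences X -> Z 1 -> K 2, K i -> Z i -> K i.+1 (1 < i < n) and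
   K n -> Z n -> E. *)
Definition splices (n : nat) E X (Z : nat -> pBanach p) (j : bop X (Z 1%N))
    (d : forall i, bop (Z i) (Z i.+1)) : bop (Z n) E -> Prop :=
  match n return bop (Z n) E -> Prop with
  | 0 => fun=> False
  | 1 => fun q => strict_ses j q
  | m.+2 => fun q =>
    exists (K : nat -> pBanach p) (k : forall i, bop (K i) (Z i))
           (r : forall i, bop (Z i) (K i.+1)),
      [/\ forall i, (0 < i < m.+2)%N -> forall z, d i z = k i.+1 (r i z),
          strict_ses j (r 1%N),
          forall i, (1 < i < m.+2)%N -> strict_ses (k i) (r i)
        & strict_ses (k m.+2) q]
  end.

(* Only the spaces ext_obj i with 1 <= i <= n and the operators ext_d i with
   1 <= i < n are part of the extension; the other values are irrelevant. *)
Record yext (n : nat) E X := YExt {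
  ext_obj : nat -> pBanach p;
  ext_in : bop X (ext_obj 1%N);
  ext_d : forall i, bop (ext_obj i) (ext_obj i.+1);
  ext_out : bop (ext_obj n) E;
  ext_splices : splices ext_in ext_d ext_out }.

Lemma ext_in_into n E X (Z : yext n E X) : into_isomorphism (ext_in Z).
Proof.
case: Z => Z j d; case: n => [|[|n]] q //=; first by case.
by case=> K [k [r [_ []]]].
Qed.

Definition ext_mor n E X (Z Z' : yext n E X) : Prop :=
  exists f : forall i, bop (ext_obj Z i) (ext_obj Z' i),
    [/\ forall x, f 1%N (ext_in Z x) = ext_in Z' x,
        forall i, (0 < i < n)%N ->
          forall z, f i.+1 (ext_d Z i z) = ext_d Z' i (f i z)
      & forall z, ext_out Z' (f n z) = ext_out Z z].

Definition ext_equiv n E X : yext n E X -> yext n E X -> Prop :=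
  clos_refl_sym_trans _ (@ext_mor n E X).

Record Ext n E X := ExtClass {
  Ext_mem : yext n E X -> Prop;
  Ext_memP : exists Z, Ext_mem = ext_equiv Z }.

Definition ext_class n E X (Z : yext n E X) : Ext n E X :=
  ExtClass (ex_intro _ Z erefl).

Lemma ext_classP n E X (Z Z' : yext n E X) :
  ext_class Z = ext_class Z' <-> ext_equiv Z Z'.
Proof.
split=> [[/(congr1 (@^~ Z'))] ->|ZZ']; first exact: rst_refl.
have e : ext_equiv Z = ext_equiv Z'.
  apply/funext => W; apply/propext; split=> h; last exact: rst_trans h.
  exact: rst_trans (rst_sym _ _ _ _ ZZ') h.
rewrite /ext_class; move: (ex_intro _ Z _) (ex_intro _ Z' _); rewrite e => h h'.
by congr ExtClass; exact: Prop_irrelevance.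
Qed.

End YonedaExtensions.

Section ExtOperations.
Context {R : realType} {p : R} (hp : 0 < p <= 1).
Implicit Types E X Y : pBanach p.

Fact inl_linear X E : linear (fun x : X => (x, 0) : dsum hp X E).
Proof. by move=> a x y; congr pair => /=; rewrite ?scaler0 ?addr0. Qed.

Fact inl_bounded X E : exists C : R, forall x : X,
  pnorm ((x, 0) : dsum hp X E) <= C * pnorm x.
Proof.
apply: (bop_of_fnorm_bounded hp); exists 1 => x.
by rewrite fnorm_dsum/= fnorm0// addr0 mul1r.
Qed.

Definition bop_inl X E : bop X (dsum hp X E) :=
  bop_of (@inl_linear X E) (@inl_bounded X E).

Fact snd_linear X E : linear (fun x : dsum hp X E => x.2).
Proof. by []. Qed.

Fact snd_bounded X E : exists C : R, forall x : dsum hp X E,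
  pnorm x.2 <= C * pnorm x.
Proof.
apply: (bop_of_fnorm_bounded hp); exists 1 => x.
by rewrite fnorm_dsum mul1r lerDr fnorm_ge0.
Qed.

Definition bop_snd X E : bop (dsum hp X E) E :=
  bop_of (@snd_linear X E) (@snd_bounded X E).

Fact dsum_strict_ses X E : strict_ses (bop_inl X E) (bop_snd X E).
Proof.
split.
- apply/(into_isomorphismP hp); exists 1 => // x.
  by rewrite fnorm_dsum/= fnorm0// addr0 mul1r.
- by move=> [x e]; split=> [/= ->|[y [_ <-]]]; first exists x.
- by move=> e; exists (0, e).
Qed.

Definition zero_ext1 E X : yext 1 E X :=
  @YExt _ _ 1 E X (fun=> dsum hp X E) (bop_inl X E)
    (fun=> bop_zero _ _) (bop_snd X E) (dsum_strict_ses X E).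

Definition zero_ext_obj m E X (i : nat) : pBanach p :=
  match i with
  | 0 | 1 => X
  | i'.+2 => if (i' < m)%N then pb_zero p else E
  end.

Definition zero_ext_out m E X : bop (zero_ext_obj m E X m.+2) E :=
  match (m < m)%N as b return bop (if b then pb_zero p else E) E with
  | true => bop_zero _ _
  | false => bop_id E
  end.

Let into_id X : into_isomorphism (bop_id X).
Proof. by apply/(into_isomorphismP hp); exists 1 => // x; rewrite mul1r. Qed.

Let into_zero X : into_isomorphism (bop_zero (pb_zero p) X).
Proof.
apply/(into_isomorphismP hp); exists 1 => // x; rewrite mul1r.
by rewrite (_ : x = 0) ?fnorm0//; exact: thinmx0.
Qed.

Let zeroP (x : pb_zero p) : x = 0. Proof. exact: thinmx0. Qed.

Fact zero_ext_splices m E X :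
  @splices _ _ m.+2 E X (zero_ext_obj m E X) (bop_id X)
    (fun=> bop_zero _ _) (zero_ext_out m E X).
Proof.
exists (fun=> pb_zero p), (fun=> bop_zero _ _), (fun=> bop_zero _ _); split=> //.
- split; first exact: into_id; last by move=> z; exists 0; rewrite (zeroP z).
  by move=> x; split=> // _; exists x.
- move=> [|[|i]]//; rewrite !ltnS /= => im; rewrite im; split.
  + exact: into_zero.
  + by move=> x; split=> // _; exists 0; rewrite (zeroP x).
  + by move=> z; exists 0; rewrite (zeroP z).
- rewrite /zero_ext_out /=; move: (ltnn m); case: (m < m)%N => // _; split.
  + exact: into_zero.
  + move=> x; split=> [/= ->|[y <-]//]; by exists 0.
  + by move=> z; exists z.
Qed.

(* X = X -> 0 -> ... -> 0 -> E = E, with Z 1 = X, Z m.+2 = E and zero spaces in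
   between. *)
Definition zero_ext_ge2 m E X : yext m.+2 E X := YExt (zero_ext_splices m E X).

End ExtOperations.

Section ZeroAndPushout.
Context {R : realType} {p : R} (hp : 0 < p <= 1).
Implicit Types E X Y : pBanach p.

(* There is no 0-extension: splices is False in degree 0. *)
Definition zero_ext (n : nat) E X : (0 < n)%N -> yext n E X :=
  match n return (0 < n)%N -> yext n E X with
  | 0 => fun h => False_rect _ (notF h)
  | 1 => fun=> zero_ext1 hp E X
  | m.+2 => fun=> zero_ext_ge2 hp m E X
  end.

Definition Ext_zero (n : nat) (hn : (0 < n)%N) E X : Ext n E X :=
  ext_class (zero_ext E X hn).

Section PushoutExt.
Variables (n : nat) (E X Y : pBanach p) (T : bop X Y) (Z : yext n E X).

Definition po_ext_obj (i : nat) : pBanach p :=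
  if i is 1 then po_space hp T (ext_in_into Z) else ext_obj Z i.

Definition po_ext_d (i : nat) : bop (po_ext_obj i) (po_ext_obj i.+1) :=
  match i return bop (po_ext_obj i) (po_ext_obj i.+1) with
  | 0 => bop_zero _ _
  | 1 => po_desc hp T (ext_in_into Z) (ext_d Z 1)
  | i'.+2 => ext_d Z i'.+2
  end.

Definition po_ext_out : bop (po_ext_obj n) E :=
  match n as m return bop (ext_obj Z m) E -> bop (po_ext_obj m) E with
  | 1 => fun q => po_desc hp T (ext_in_into Z) q
  | _ => fun q => q
  end (ext_out Z).

End PushoutExt.

Fact po_ext_splices n E X Y (T : bop X Y) (Z : yext n E X) :
  splices (po_in hp T (ext_in_into Z)) (po_ext_d T Z) (po_ext_out T Z).
Proof.
rewrite /po_ext_out /po_ext_d /po_ext_obj.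
move: (ext_in_into Z); case: Z => Z j d /=; case: n => [|[|m]] q //=.
  by move=> s hj; exact: po_strict_ses.
move=> [K [k [r [dE s1 si sn]]]] hj.
pose O i : pBanach p := if i is 1 then po_space hp T hj else Z i.
pose k' i : bop (K i) (O i) :=
  match i return bop (K i) (O i) with
  | 0 => k 0%N | 1 => bop_zero _ _ | i'.+2 => k i'.+2
  end.
pose r' i : bop (O i) (K i.+1) :=
  match i return bop (O i) (K i.+1) with
  | 0 => r 0%N | 1 => po_desc hp T hj (r 1%N) | i'.+2 => r i'.+2
  end.
have r1j x : r 1%N (j x) = 0 by case: s1 => _ ex _; apply/ex; exists x.
exists K, k', r'; split=> //.
- move=> [//|[|i]] hi z; last exact: dE.
  have [y [w <-]] := po_surj z.
  have dw v : d 1%N v = k 2%N (r 1%N v) by exact: dE.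
  rewrite /= !po_descE// => x.
  by rewrite dw r1j linear0.
- exact: po_strict_ses.
- by move=> [|[|i]]//; exact: si.
Qed.

Definition pushout_ext n E X Y (T : bop X Y) (Z : yext n E X) : yext n E Y :=
  YExt (po_ext_splices T Z).

End ZeroAndPushout.

Section NConstruction.
Context {R : realType} {p : R} (hp : 0 < p <= 1).
Variables (n : nat) (E X : pBanach p) (A : choiceType) (rep : A -> yext n E X).

(* rep chooses one representative in each class, so that A is a copy of
   Ext n E X; Ext n E X itself lives in a universe too large to be the index
   type of a sum of p-Banach spaces. The normalization is void when X = 0. *)
Definition representatives :=
  bijective (fun a => ext_class (rep a)) /\
  ((exists x : X, x <> 0) -> forall a, bop_norm (ext_in (rep a)) = 1).

(* Holds e.g. when the embeddings are isometric. Since every x in X satisfies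
   |rho x| <= inf_a |ext_in (rep a) x| for the canonical map rho : X -> N_space,
   this is exactly what makes rho an into isomorphism; norm one embeddings alone
   do not suffice. *)
Definition uniformly_into :=
  exists2 c : R, 0 < c &
    forall a x, c * pnorm x <= pnorm (ext_in (rep a) x).

Definition Z1_sum : pBanach p := lp_sum hp (fun a => ext_obj (rep a) 1).

Definition cross_elements : set Z1_sum :=
  [set w : Z1_sum | exists (x : X) (a a' : A),
    [/\ a <> a', lp_val w a = ext_in (rep a) x,
        lp_val w a' = - ext_in (rep a') x
      & forall b, b <> a -> b <> a' -> lp_val w b = 0]].

Definition N_space : pBanach p :=
  pb_quot hp (closed_span_closed cross_elements).

End NConstruction.

(* Main.v *)
Require Import Defs.
From HB Require Import structures.
From mathcomp Require Import all_boot all_order all_algebra.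
From mathcomp Require Import all_classical all_reals all_analysis.
From Stdlib Require Import Relation_Operators.

(** If [a] is the class of [Z] and [j_a] the embedding of [X] into [Z_{1,a}],
    the maps [X -> Z_{1,a} -> N] agree for all [a], so [rho] extends to [Z_{1,a}]; a
    push-out along a map that extends to the first space splits. Approximating an
    element of [X_A] by finite families [(j_b x_b)] with [sum x_b = 0], the
    triangle inequality for the p-th power of the norm and the uniform lower
    bound on the embeddings bound [rho] from below.

    That the classes form a small set is seen without projective objects: every
    extension contains a sub-extension whose elements are named by terms built
    from [E] and [X], hence is determined up to equivalence by the norms of these
    terms and their images in [E]. Scaling the norms and pushing out along the
    identity of [X] makes the embedding isometric. *)

Set Implicit Arguments.
Unset Strict Implicit.
Unset Printing Implicit Defensive.

Import Order.TTheory GRing.Theory Num.Theory.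
Local Open Scope classical_set_scope.
Local Open Scope ring_scope.

(** * Bounded operators, quotients and closed subspaces *)

Section BoundedOperators.
Context {R : realType} {p : R} (hp : 0 < p <= 1).
Implicit Types V X Y Z : pBanach p.

Fact bop_comp_linear X Y Z (g : bop Y Z) (f : bop X Y) :
  linear (fun x => g (f x)).
Proof. by move=> a x y; rewrite !linearP. Qed.

Fact bop_comp_bounded X Y Z (g : bop Y Z) (f : bop X Y) :
  exists C : R, forall x, pnorm (g (f x)) <= C * pnorm x.
Proof.
have [C C0 hC] := bop_boundedP g; have [D D0 hD] := bop_boundedP f.
exists (C * D) => x; rewrite (le_trans (hC _))// -mulrA ler_pM2l//.
Qed.

Definition bop_comp X Y Z (g : bop Y Z) (f : bop X Y) : bop X Z :=
  bop_of (bop_comp_linear g f) (bop_comp_bounded g f).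

Fact bop_add_linear X Y (f g : bop X Y) : linear (fun x => f x + g x).
Proof. by move=> a x y; rewrite !linearP scalerDr addrACA. Qed.

Fact bop_add_bounded X Y (f g : bop X Y) :
  exists C : R, forall x, pnorm (f x + g x) <= C * pnorm x.
Proof.
apply: (bop_of_fnorm_bounded hp).
have [C C0 hC] := fnorm_bop hp f; have [D D0 hD] := fnorm_bop hp g.
by exists (C + D) => x; rewrite (le_trans (fnormD _ _))// mulrDl lerD.
Qed.

Definition bop_add X Y (f g : bop X Y) : bop X Y :=
  bop_of (bop_add_linear f g) (bop_add_bounded f g).

Fact fst_bounded X Y :
  exists C : R, forall x : dsum hp X Y, pnorm x.1 <= C * pnorm x.
Proof.
apply: (bop_of_fnorm_bounded hp); exists 1 => x.
by rewrite fnorm_dsum mul1r lerDl fnorm_ge0.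
Qed.

Definition bop_fst X Y : bop (dsum hp X Y) X :=
  @bop_of _ _ (dsum hp X Y) X (fun x => x.1) (fun _ _ _ => erefl)
    (fst_bounded X Y).

Fact inr_linear X Y : linear (fun y : Y => (0, y) : dsum hp X Y).
Proof. by move=> a x y; congr pair => /=; rewrite ?scaler0 ?addr0. Qed.

Fact inr_bounded X Y : exists C : R, forall y : Y,
  pnorm ((0, y) : dsum hp X Y) <= C * pnorm y.
Proof.
apply: (bop_of_fnorm_bounded hp); exists 1 => x.
by rewrite fnorm_dsum/= fnorm0// add0r mul1r.
Qed.

Definition bop_inr X Y : bop Y (dsum hp X Y) :=
  bop_of (@inr_linear X Y) (@inr_bounded X Y).

Section QuotientOperators.
Variables (V : pBanach p) (W : set V) (cW : closed_subspace W).

Fact quot_pi_bounded : exists C : R, forall x : V,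
  pnorm (quot_pi cW.1 x : pb_quot hp cW) <= C * pnorm x.
Proof.
apply: (bop_of_fnorm_bounded hp); exists 1 => x.
by rewrite mul1r; exact: (quot_fnorm_le hp).
Qed.

Definition bop_pi : bop V (pb_quot hp cW) :=
  @bop_of _ _ V (pb_quot hp cW) _ (quot_pi_linear cW.1) quot_pi_bounded.

(** Since [f] kills [W], its value on a representative depends only on the coset. Lifts of almost
    minimal norm carry the bound of [f] over to [g]. *)
Lemma quot_factor Y (f : bop V Y) : (forall w, W w -> f w = 0) ->
  exists g : bop (pb_quot hp cW) Y, forall x, g (quot_pi cW.1 x) = f x.
Proof.
move=> fW; pose g (a : pb_quot hp cW) : Y := f (repr (a : quot cW.1)).
have gE x : g (quot_pi cW.1 x) = f x.
  apply/eqP; rewrite -subr_eq0 -linearB; apply/eqP/fW; exact: quot_repr.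
have lg : linear g.
  move=> a u v; have [x <-] := quot_pi_surj u; have [y <-] := quot_pi_surj v.
  by rewrite -quot_pi_linear !gE linearP.
have bg : exists C : R, forall a, pnorm (g a) <= C * pnorm a.
  have [C C0 hC] := fnorm_bop hp f.
  apply: (bop_of_fnorm_bounded hp); exists C => a.
  rewrite -ler_pdivrMl//; apply/ler_addgt0Pr => e e0.
  have [x <- hx] := quot_fnorm_lift hp (cW := cW) a e0.
  by rewrite (le_trans _ (ltW hx))// gE ler_pdivrMl.
by exists (bop_of lg bg).
Qed.

End QuotientOperators.

(** The map sending [(y, z)] to [f y + g z] kills every [(T x, - j x)], hence descends to the
    push-out. *)
Lemma po_factor X Y Z V (T : bop X Y) (j : bop X Z) (hj : into_isomorphism j)
    (f : bop Y V) (g : bop Z V) : (forall x, f (T x) = g (j x)) ->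
  exists h : bop (po_space hp T hj) V,
    forall y z, h (po_pi hp T hj y z) = f y + g z.
Proof.
move=> fg.
have [|h hE] := @quot_factor _ _ (po_graph_closed hp T hj) V
    (bop_add (bop_comp f (bop_fst Y Z)) (bop_comp g (bop_snd hp Y Z))).
  by move=> _ [x _ <-]; rewrite /= fg linearN subrr.
by exists h => y z; exact: hE.
Qed.

Section ClosedSubspaces.
Variables (V : pBanach p) (W : set V).

(* The unused arguments make M and the proofs recoverable by unification. *)
Definition sub_pred (M : R) of 0 < M & closed_subspace W : {pred V} :=
  fun x => `[< W x >].

Variables (M : R) (M0 : 0 < M) (cW : closed_subspace W).

Fact sub_pred_submod : submod_closed (sub_pred M0 cW).
Proof.
split=> [|a x y /asboolP Wx /asboolP Wy]; apply/asboolP; first exact: cW.1.1.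
exact: cW.1.2.
Qed.

HB.instance Definition _ :=
  GRing.isSubmodClosed.Build R V (sub_pred M0 cW) sub_pred_submod.

Record sub_type := SubType { sub_val : V; _ : sub_pred M0 cW sub_val }.
HB.instance Definition _ := [isSub for sub_val].
HB.instance Definition _ := [Choice of sub_type by <:].
HB.instance Definition _ := [SubChoice_isSubLmodule of sub_type by <:].

(** Rescaling by [M] serves later to make the embedding of [X] norm-nondecreasing. *)
Definition sub_norm (x : sub_type) : R := M * pnorm (sub_val x).

Fact sub_norm_ge0 x : 0 <= sub_norm x.
Proof. by rewrite mulr_ge0 ?pnorm_ge0// ltW. Qed.

Fact sub_norm_eq0 x : sub_norm x = 0 -> x = 0.
Proof.
move=> /eqP; rewrite mulf_eq0 gt_eqF//= => /eqP /pnorm_eq0 x0.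
exact: val_inj.
Qed.

Fact sub_normZ a x : sub_norm (a *: x) = `|a| * sub_norm x.
Proof. by rewrite /sub_norm [sub_val _]/= pnormZ mulrCA. Qed.

Fact sub_normD x y :
  sub_norm (x + y) `^ p <= sub_norm x `^ p + sub_norm y `^ p.
Proof.
rewrite /sub_norm !powRM ?pnorm_ge0 ?(ltW M0)// -mulrDr.
by rewrite ler_wpM2l ?powR_ge0//; exact: pnormD.
Qed.

Fact sub_norm_complete : nrm_complete sub_norm.
Proof.
move=> u cu; have [|l hl] := @pnorm_complete _ _ V (sub_val \o u).
  move=> e e0; have [|N hN] := cu (M * e); first exact: mulr_gt0.
  by exists N => m n hm hn; rewrite -(ltr_pM2l M0); exact: hN.
have Wl : sub_pred M0 cW l.
  apply/asboolP; apply: (cW.2 (sub_val \o u)) => // n /=.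
  by case: (u n) => x /= /asboolP.
exists (SubType Wl) => e e0; have [|N hN] := hl (e / M); first exact: divr_gt0.
exists N => n hn; rewrite /sub_norm mulrC -ltr_pdivlMr//; exact: hN.
Qed.

Definition pb_sub : pBanach p :=
  @PBanach _ _ sub_type sub_norm sub_norm_ge0 sub_norm_eq0 sub_normZ sub_normD
    sub_norm_complete.

Lemma sub_valP (x : pb_sub) : W (sub_val x).
Proof. by case: x => x /= /asboolP. Qed.

Lemma sub_surj x : W x -> exists y : pb_sub, sub_val y = x.
Proof. by move=> /asboolP Wx; exists (@SubType x Wx). Qed.

Lemma pnorm_sub (x : pb_sub) : pnorm x = M * pnorm (sub_val x).
Proof. by []. Qed.

Fact sub_val_bounded :
  exists C : R, forall x : pb_sub, pnorm (sub_val x) <= C * pnorm x.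
Proof. by exists M^-1 => x; rewrite pnorm_sub mulKf// gt_eqF. Qed.

Definition bop_incl : bop pb_sub V :=
  @bop_of _ _ pb_sub V sub_val (fun _ _ _ => erefl) sub_val_bounded.

Section Corestriction.
Variables (X : pBanach p) (f : bop X V) (fW : forall x, W (f x)).

Definition corestr_fun (x : X) : pb_sub := @SubType (f x) (asboolT (fW x)).

Fact corestr_linear : linear corestr_fun.
Proof. by move=> a x y; apply: val_inj; exact: linearP. Qed.

Fact corestr_bounded :
  exists C : R, forall x, pnorm (corestr_fun x) <= C * pnorm x.
Proof.
have [C C0 hC] := bop_boundedP f.
by exists (M * C) => x; rewrite pnorm_sub -mulrA ler_pM2l//; exact: hC.
Qed.

Definition bop_corestr : bop X pb_sub := bop_of corestr_linear corestr_bounded.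

End Corestriction.

Lemma incl_into : into_isomorphism bop_incl.
Proof.
split.
  by exists M^-1 => [|x]; rewrite ?invr_gt0// pnorm_sub mulKf ?gt_eqF.
move=> u l hu ul; have [|y yl] := @sub_surj l; last by exists y.
by apply: (cW.2 u) => // n; have [y _ <-] := hu n; exact: sub_valP.
Qed.

End ClosedSubspaces.

End BoundedOperators.

(** * Spliced sequences as exact sequences *)

Section Splicing.
Context {R : realType} {p : R} (hp : 0 < p <= 1).
Implicit Types E X Y : pBanach p.

Lemma ker_closed_subspace X Y (f : bop X Y) :
  closed_subspace [set x | f x = 0].
Proof.
split; first split=> [|a x y /= fx fy]; rewrite /= ?linear0//.
  by rewrite linearP fx fy scaler0 addr0.
move=> u l fu /(nrm_cvg_fnorm hp) /(bop_cvg hp f) ul.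
apply: (nrm_cvg_unique (u := f \o u)) => // e e0; exists 0%N => n _.
by rewrite /= fu subrr fnorm0.
Qed.

Lemma closed_span_sub X (S : set X) x : S x -> closed_span S x.
Proof. by move=> Sx M [_]; exact. Qed.

Lemma closed_span_id X (W : set X) : closed_subspace W -> closed_span W = W.
Proof.
move=> cW; apply/seteqP; split=> x; last exact: closed_span_sub.
by move=> /(_ W); apply; split.
Qed.

(** By exactness the range of [f] is the kernel of [g], hence already closed. *)
Lemma closed_span_range X Y V (f : bop X Y) (g : bop Y V) :
    (forall y, g y = 0 <-> exists x, f x = y) ->
  closed_span (range f) = range f.
Proof.
move=> ex; suff -> : range f = [set y | g y = 0].
  exact/closed_span_id/ker_closed_subspace.
by apply/seteqP; split=> y => [[x _ <-]|/ex[x <-]]; [apply/ex|]; exists x.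
Qed.

Lemma into_isomorphism_eq0 X Y (f : bop X Y) x :
  into_isomorphism f -> f x = 0 -> x = 0.
Proof.
move=> [[c c0 hc] _] fx; apply: pnorm_eq0; apply/eqP.
rewrite eq_le pnorm_ge0 andbT -(pmulr_rle0 _ c0) (le_trans (hc x))//.
by rewrite fx pnorm0.
Qed.

(** Each range of a differential in an exact sequence is a kernel, hence closed, and can serve as
    the intermediate space of the splicing. Conversely, the maps [k i] are injective and the maps
    [r i] surjective, so kernels and ranges of [d i] are those of [r i] and [k i.+1]. *)
Lemma splices_ge2P m E X (Z : nat -> pBanach p) (j : bop X (Z 1%N))
    (d : forall i, bop (Z i) (Z i.+1)) (q : bop (Z m.+2) E) :
  @splices _ _ m.+2 _ _ _ j d q <->
  [/\ into_isomorphism j,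
      forall z, d 1%N z = 0 <-> exists x, j x = z,
      forall i, (0 < i < m.+1)%N ->
        forall z, d i.+1 z = 0 <-> exists y, d i y = z,
      forall z, q z = 0 <-> exists y, d m.+1 y = z
    & forall e, exists z, q z = e].
Proof.
split=> [[K [k [r [dE [ij exj sj] si [ik exk sq]]]]]|[ij exj exd exq sq]].
  have ki i : (1 < i <= m.+2)%N -> into_isomorphism (k i).
    move=> /andP[i1]; rewrite leq_eqVlt => /predU1P[->//|im].
    by have [] := si i; rewrite ?i1.
  have rs i : (0 < i < m.+2)%N -> forall y, exists z, r i z = y.
    case: i => // -[//|i] im; by have [] := si i.+2.
  have d0 i : (0 < i < m.+2)%N -> forall z, d i z = 0 <-> r i z = 0.
    move=> im z; rewrite dE//; split=> [|->]; last by rewrite linear0.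
    by apply: into_isomorphism_eq0; apply: ki; rewrite ltnS.
  have exd i : (0 < i < m.+2)%N -> forall z,
      (exists y, k i.+1 y = z) <-> exists y, d i y = z.
    move=> im z; split=> [[y <-]|[y <-]]; last by exists (r i y); rewrite dE.
    by have [w <-] := rs i im y; exists w; rewrite dE.
  split=> //.
  - by move=> z; rewrite d0.
  - move=> i /andP[i0 im] z; rewrite d0 ?ltnS//.
    have [|_ -> _] := si i.+1; first by rewrite !ltnS i0.
    by rewrite exd// i0 ltnW.
  - by move=> z; rewrite exk exd//= ltnSn.
have spd i : (0 < i < m.+2)%N -> closed_span (range (d i)) = range (d i).
  move=> /andP[i0]; rewrite ltnS leq_eqVlt => /predU1P[->|im].
    exact: closed_span_range exq.
  by apply: (closed_span_range (g := d i.+1)); apply: exd; rewrite i0.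
(* The closed span makes [K] meaningful at every index; [spd] identifies it with the range at the
   indices that belong to the extension. *)
pose K i : pBanach p := match i with
  | 0 => pb_zero p
  | i'.+1 => pb_sub ltr01 (closed_span_closed (range (d i')))
  end.
pose k i : bop (K i) (Z i) := match i return bop (K i) (Z i) with
  | 0 => bop_zero _ _
  | i'.+1 => bop_incl ltr01 (closed_span_closed (range (d i')))
  end.
have dr i z : closed_span (range (d i)) (d i z).
  by apply: closed_span_sub; exists z.
pose r i : bop (Z i) (K i.+1) :=
  bop_corestr ltr01 (closed_span_closed _) (dr i).
have r0 i z : r i z = 0 <-> d i z = 0.
  by split=> [/(congr1 val)|dz]; last exact: val_inj.
have rs i : (0 < i < m.+2)%N -> forall y, exists z, r i z = y.
  move=> im y; have := sub_valP y; rewrite {1}spd// => -[z _ zy].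
  by exists z; exact: val_inj.
have exk i : (0 < i < m.+2)%N -> forall z,
    (exists y, d i y = z) <-> exists y, k i.+1 y = z.
  move=> im z; split=> [[y <-]|[y <-]]; first by exists (r i y).
  by have [w <-] := rs i im y; exists w.
exists K, k, r; split=> //.
- by split=> // [z|]; [rewrite r0|exact: rs].
- move=> [|i]// /andP[i0 im]; split; [exact: incl_into| |].
    have im' : (0 < i < m.+1)%N by apply/andP.
    by move=> z; rewrite r0 (exd i im') exk//; move: im' => /andP[-> /ltnW].
  by apply: rs.
- split=> //; first exact: incl_into.
  by move=> z; rewrite exq exk//= ltnSn.
Qed.

End Splicing.

(* Names for the elements of the spaces of an extension that can be reached from
   E and X: values of a set-theoretic section of the last map, the image of X,
   linear combinations, limits of sequences, values of the differentials and
   chosen preimages under them. The same term may be evaluated in every degree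
   of every extension of E by X. *)
Inductive term (R E X : Type) : Type :=
| TOut of E
| TIn of X
| TLin of R & term R E X & term R E X
| TLim of nat -> term R E X
| TDiff of term R E X
| TLift of term R E X.
Arguments TOut {R E X}.
Arguments TIn {R E X}.

(** * Evaluation of terms in an extension *)

Section Evaluation.
Context {R : realType} {p : R} (hp : 0 < p <= 1).
Variables (n : nat) (E X : pBanach p) (Z : yext n E X).
Local Notation tm := (term R E X).
Local Notation Zo := (ext_obj Z).

(** Evaluation is total: the value is 0 where a generator has the wrong degree or where no limit or
    preimage exists. *)
Fixpoint eval (t : tm) (i : nat) : Zo i :=
  match t with
  | TOut e => dfwith (fun i => 0 : Zo i) n (xget 0 [set z | ext_out Z z = e]) i
  | TIn x => match i return Zo i with 1 => ext_in Z x | _ => 0 end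
  | TLin a t t' => a *: eval t i + eval t' i
  | TLim u => xget 0 [set l | nrm_cvg (@pnorm _ _ _) (fun k => eval (u k) i) l]
  | TDiff t => match i return Zo i with
               | 0 => 0
               | i'.+1 => ext_d Z i' (eval t i')
               end
  | TLift t => xget 0 [set y | ext_d Z i y = eval t i.+1]
  end.

Definition eval_range i : set (Zo i) := range (eval^~ i).
Arguments eval_range : clear implicits.

Lemma eval_range_closed i : closed_subspace (eval_range i).
Proof.
split; first split=> [|a _ _ [t _ <-] [t' _ <-]].
(* This term has value 0 in every degree, also in degree 1. *)
- exists (TIn 0) => //=; case: i => [|[|i]]//; exact: linear0.
- by exists (TLin a t t').
move=> u l hu ul.
have /choice[t ht] : forall k, exists t, eval t i = u k.
  by move=> k; have [t _ <-] := hu k; exists t.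
exists (TLim t) => //=; have -> : (fun k => eval (t k) i) = u by exact/funext.
apply: (nrm_cvg_unique (u := u)); last exact/(nrm_cvg_fnorm hp).
by apply/(nrm_cvg_fnorm hp); apply: (xgetPex 0); exists l.
Qed.

End Evaluation.

Arguments eval_range {R p n E X} Z i _.

(** * The sub-extension of named elements and its code *)

Section SubExtension.
Context {R : realType} {p : R} (hp : 0 < p <= 1).
Variables (E X : pBanach p).

Section Def.
Variables (n : nat) (Z : yext n E X) (M : R) (M0 : 0 < M).

Definition sub_obj i : pBanach p := pb_sub M0 (eval_range_closed hp Z i).

Fact eval_range_in x : eval_range Z 1 (ext_in Z x).
Proof. by exists (TIn x). Qed.

Fact eval_range_d i z : eval_range Z i z -> eval_range Z i.+1 (ext_d Z i z).
Proof. by move=> [t _ <-]; exists (TDiff t). Qed.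

Fact sub_d_range i (z : sub_obj i) :
  eval_range Z i.+1 (bop_comp (ext_d Z i) (bop_incl M0 _) z).
Proof. by apply: eval_range_d; exact: sub_valP. Qed.

Definition sub_in : bop X (sub_obj 1) :=
  bop_corestr M0 (eval_range_closed hp Z 1) eval_range_in.

Definition sub_d i : bop (sub_obj i) (sub_obj i.+1) :=
  bop_corestr M0 (eval_range_closed hp Z i.+1) (@sub_d_range i).

Definition sub_out : bop (sub_obj n) E := bop_comp (ext_out Z) (bop_incl M0 _).

(** The preimage chosen by [TLift] is itself the value of a term, so exactness survives the passage
    to named elements. *)
Lemma eval_range_lift i z : eval_range Z i.+1 z ->
  (exists y, ext_d Z i y = z) -> exists2 y, eval_range Z i y & ext_d Z i y = z.
Proof.
move=> [t _ <-] exy; exists (eval Z (TLift t) i); first by exists (TLift t).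
exact: (xgetPex 0 exy).
Qed.

Lemma eval_range_out e :
  (exists z, ext_out Z z = e) -> exists2 z, eval_range Z n z & ext_out Z z = e.
Proof.
move=> exz; exists (eval Z (TOut e) n); first by exists (TOut e).
by rewrite /= dfwithin; exact: (xgetPex 0 exz).
Qed.

Lemma sub_in_into : into_isomorphism sub_in.
Proof.
have [c c0 hc] := (into_isomorphismP hp _).1 (ext_in_into Z).
apply/(into_isomorphismP hp); exists (M `^ p * c).
  by rewrite mulr_gt0 ?powR_gt0.
move=> x.
have -> : fnorm (sub_in x) = M `^ p * fnorm (ext_in Z x).
  by rewrite /fnorm pnorm_sub powRM ?pnorm_ge0 ?(ltW M0).
by rewrite -mulrA ler_wpM2l ?powR_ge0//; exact: hc.
Qed.

End Def.

(** Kernels are computed in [Z]. Preimages among the named elements come from [eval_range_lift] and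
    [eval_range_out], and [TIn] names the whole image of [X]. *)
Fact sub_splices n (Z : yext n E X) (M : R) (M0 : 0 < M) :
  splices (sub_in Z M0) (sub_d Z M0) (sub_out Z M0).
Proof.
have vi i z := @sub_valP _ _ _ _ _ M0 (eval_range_closed hp Z i) z.
have v0 i (z : sub_obj Z M0 i) : z = 0 <-> sub_val z = 0.
  by split=> [->//|z0]; exact: val_inj.
have lift i (z : sub_obj Z M0 i.+1) :
    (exists y, ext_d Z i y = sub_val z) <-> exists y, sub_d Z M0 i y = z.
  split=> [/(eval_range_lift (vi _ _))[y yW yz]|[y <-]]; last first.
    by exists (sub_val y).
  have [w wy] := @sub_surj _ _ _ _ _ M0 (eval_range_closed hp Z i) y yW.
  by exists w; apply: val_inj; rewrite /= wy.
have jlift (z : sub_obj Z M0 1) :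
    (exists x, ext_in Z x = sub_val z) <-> exists x, sub_in Z M0 x = z.
  by split=> [] [x xz]; exists x; [exact: val_inj|rewrite -xz].
have qlift e : (exists z, ext_out Z z = e) -> exists z, sub_out Z M0 z = e.
  move=> /eval_range_out[z zW <-].
  have [w wz] := @sub_surj _ _ _ _ _ M0 (eval_range_closed hp Z n) z zW.
  by exists w; rewrite /= wz.
have ji := sub_in_into Z M0; have := ext_splices Z.
case: n Z vi v0 lift jlift qlift ji => [//|[|m]] Z vi v0 lift jlift qlift ji.
  move=> [_ exj sq]; split=> // [z|e]; last exact: qlift.
  by rewrite -jlift -exj.
move=> /(splices_ge2P hp)[_ exj exd exq sq].
apply/(splices_ge2P hp); split=> //.
- by move=> z; rewrite v0 -jlift -exj.
- by move=> i im z; rewrite v0 -lift -(exd i im).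
- by move=> z; rewrite -lift -exq.
- by move=> e; exact: qlift.
Qed.

Definition sub_ext n (Z : yext n E X) (M : R) (M0 : 0 < M) : yext n E X :=
  YExt (sub_splices Z M0).

Lemma sub_ext_mor n (Z : yext n E X) (M : R) (M0 : 0 < M) :
  ext_mor (sub_ext Z M0) Z.
Proof. by exists (fun i => bop_incl M0 (eval_range_closed hp Z i)). Qed.

(* Since terms are closed under linear combinations and differentials, these
   data determine the extension formed by the ranges of eval up to isometry. *)
Definition ext_code n (Z : yext n E X) :
    (nat -> term R E X -> R) * (term R E X -> E) :=
  (fun i t => pnorm (eval Z t i), fun t => ext_out Z (eval Z t n)).

(** The morphism sends the value of a term in [Z] to its value in [Z']. It is well defined because
    the difference of two values is again the value of a term, whose norm is the same in both
    extensions. *)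
Lemma sub_ext_code n (Z Z' : yext n E X) : ext_code Z = ext_code Z' ->
  ext_mor (sub_ext Z ltr01) (sub_ext Z' ltr01).
Proof.
move=> [nE oE].
have evN i t : pnorm (eval Z t i) = pnorm (eval Z' t i).
  by have /(congr1 (fun f => f i t)) := nE.
have evE i t t' : eval Z t i = eval Z t' i -> eval Z' t i = eval Z' t' i.
  move=> e; apply/subr0_eq/pnorm_eq0.
  (* This term names the difference of the values of [t] and [t']. *)
  have := evN i (TLin (-1) t' t); rewrite /= !scaleN1r ![- _ + _]addrC => <-.
  by rewrite e subrr pnorm0.
have fE i (z : sub_obj Z ltr01 i) : exists w : sub_obj Z' ltr01 i,
    forall t, sub_val z = eval Z t i -> sub_val w = eval Z' t i.
  have [t _ tz] := sub_valP z.
  have [|w wE] :=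
    @sub_surj _ _ _ _ _ ltr01 (eval_range_closed hp Z' i) (eval Z' t i).
    by exists t.
  by exists w => t'; rewrite -tz wE => /evE.
pose f i z := projT1 (cid (fE i z)).
have ff i z t : sub_val z = eval Z t i -> sub_val (f i z) = eval Z' t i.
  exact: (projT2 (cid (fE i z))).
have evx i (z : sub_obj Z ltr01 i) : exists t, sub_val z = eval Z t i.
  by have [t _ tz] := sub_valP z; exists t.
have lf i : linear (f i).
  move=> a x y; have [t tx] := evx i x; have [t' ty] := evx i y.
  apply: val_inj; rewrite /= (ff _ _ _ tx) (ff _ _ _ ty).
  by rewrite (ff _ _ (TLin a t t'))//= tx ty.
have bf i : exists C : R, forall z, pnorm (f i z) <= C * pnorm z.
  exists 1 => z; rewrite !pnorm_sub !mul1r; have [t tz] := evx i z.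
  by rewrite (ff _ _ _ tz) tz evN.
exists (fun i => bop_of (lf i) (bf i)); split.
- by move=> x; apply: val_inj => /=; rewrite (ff _ _ (TIn x)).
- move=> i _ z; have [t tz] := evx i z; apply: val_inj => /=.
  by rewrite (ff _ _ (TDiff t))/= ?tz// (ff _ _ _ tz).
- move=> z; have [t tz] := evx n z; rewrite /= (ff _ _ _ tz) tz.
  by have /(congr1 (fun f => f t)) := oE.
Qed.

(** The zigzag runs from [Z] back to its sub-extension, across to that of [Z'], and on into [Z']. *)
Lemma ext_equiv_code n (Z Z' : yext n E X) :
  ext_code Z = ext_code Z' -> ext_equiv Z Z'.
Proof.
move=> /sub_ext_code m; apply: rst_trans (rst_sym _ _ _ _ _) _.
  exact/rst_step/(sub_ext_mor Z ltr01).
apply: rst_trans (rst_step _ _ _ _ m) _; exact/rst_step/sub_ext_mor.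
Qed.

End SubExtension.

(** * Functoriality of push-outs and isometric representatives *)

Section PushoutMorphisms.
Context {R : realType} {p : R} (hp : 0 < p <= 1).
Implicit Types E X Y V : pBanach p.

Definition bop_po_inr X Y V (T : bop X Y) (j : bop X V)
    (hj : into_isomorphism j) : bop V (po_space hp T hj) :=
  bop_comp (bop_pi hp (po_graph_closed hp T hj)) (bop_inr hp Y V).

Lemma po_piE X Y V (T : bop X Y) (j : bop X V)
    (hj : into_isomorphism j) y z :
  po_pi hp T hj y z = po_in hp T hj y + bop_po_inr T hj z.
Proof.
rewrite /po_pi; have -> : (y, z) = (1 : R) *: (y, 0) + (0, z) :> dsum hp Y V.
  by rewrite scale1r; congr pair => /=; rewrite ?addr0 ?add0r.
by rewrite quot_pi_linear scale1r.
Qed.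

Lemma po_in_inr X Y V (T : bop X Y) (j : bop X V)
    (hj : into_isomorphism j) x :
  po_in hp T hj (T x) = bop_po_inr T hj (j x).
Proof. by apply/po_pi_eq; exists x; rewrite !subr0. Qed.

Lemma ext_d_in m E X (Z : yext m.+2 E X) x : ext_d Z 1 (ext_in Z x) = 0.
Proof.
by have /(splices_ge2P hp)[_ exj _ _ _] := ext_splices Z; apply/exj; exists x.
Qed.

Lemma ext_out_d m E X (Z : yext m.+2 E X) z : ext_out Z (ext_d Z m.+1 z) = 0.
Proof.
by have /(splices_ge2P hp)[_ _ _ exq _] := ext_splices Z; apply/exq; exists z.
Qed.

Lemma ext_out_in E X (Z : yext 1 E X) x : ext_out Z (ext_in Z x) = 0.
Proof. by have [_ ex _] := ext_splices Z; apply/ex; exists x. Qed.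

(** In degree 1 the universal property of the push-out provides the map sending the class of
    [(y, z)] to that of [(y, f 1 z)]; the other degrees keep [f]. *)
Lemma pushout_ext_mor n E X Y (T : bop X Y) (Z Z' : yext n E X) :
  ext_mor Z Z' -> ext_mor (pushout_ext hp T Z) (pushout_ext hp T Z').
Proof.
move=> [f [fj fd fq]].
have [|g gE] := po_factor hp (ext_in_into Z) (T := T)
  (f := po_in hp T (ext_in_into Z'))
  (g := bop_comp (bop_po_inr T (ext_in_into Z')) (f 1%N)).
  by move=> x; rewrite po_in_inr /= fj.
have gE' y z : g (po_pi hp T (ext_in_into Z) y z) =
    po_pi hp T (ext_in_into Z') y (f 1%N z).
  by rewrite gE [RHS]po_piE.
pose h i : bop (po_ext_obj hp T Z i) (po_ext_obj hp T Z' i) :=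
  match i return bop (po_ext_obj hp T Z i) (po_ext_obj hp T Z' i) with
  | 1 => g | 0 => f 0%N | i'.+2 => f i'.+2
  end.
exists h; split.
- by move=> y /=; rewrite gE' linear0.
- move=> [|[|i]]// hi z; last exact: fd.
  have [y [w <-]] := po_surj z.
  case: n Z Z' f fj fd fq g gE gE' @h hi z y w => [//|[//|m]].
  move=> Z Z' f fj fd fq g gE gE' h _ _ y w /=.
  by rewrite gE' !po_descE ?fd//; exact: ext_d_in.
- case: n Z Z' f fj fd fq g gE gE' @h => [|[|m]] Z Z' f fj fd fq g gE gE' h z.
  + by have := ext_splices Z.
  + have [y [w <-]] := po_surj z.
    by rewrite /= gE' !po_descE ?fq//; exact: ext_out_in.
  + exact: fq.
Qed.

Lemma pushout_ext_equiv n E X Y (T : bop X Y) (Z Z' : yext n E X) :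
  ext_equiv Z Z' -> ext_equiv (pushout_ext hp T Z) (pushout_ext hp T Z').
Proof.
elim=> [U V /(pushout_ext_mor T)|U|U V _|U V W _ + _].
- exact: rst_step.
- exact: rst_refl.
- exact: rst_sym.
- exact: rst_trans.
Qed.

Lemma pushout_id_mor n E X (Z : yext n E X) :
  ext_mor Z (pushout_ext hp (bop_id X) Z).
Proof.
pose h i : bop (ext_obj Z i) (po_ext_obj hp (bop_id X) Z i) :=
  match i return bop (ext_obj Z i) (po_ext_obj hp (bop_id X) Z i) with
  | 1 => bop_po_inr (bop_id X) (ext_in_into Z)
  | 0 => bop_id _ | i'.+2 => bop_id _
  end.
exists h; split.
- by move=> x; exact: (esym (po_in_inr (bop_id X) (ext_in_into Z) x)).
- move=> [|[|i]]// hi z.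
  case: n Z @h hi z => [//|[//|m]] Z h _ z /=.
  by rewrite po_descE//; exact: ext_d_in.
- case: n Z @h => [|[|m]] Z h z //.
  by rewrite /= po_descE//; exact: ext_out_in.
Qed.

(** The p-th power of the norm of the class of [(y, 0)] is the infimum over [x] of
    [fnorm (y + x) + fnorm (j x)]. This is at most [fnorm y], by [x = 0], and at least [fnorm y]
    because [j] does not decrease norms. *)
Lemma po_in_id_isometric X V (j : bop X V) (hj : into_isomorphism j) :
  (forall x, pnorm x <= pnorm (j x)) ->
  forall x, pnorm (po_in hp (bop_id X) hj x) = pnorm x.
Proof.
move=> jge y; have p0 : 0 < p by case/andP: hp.
apply: (powR_injective p0); rewrite ?nnegrE ?pnorm_ge0//.
apply/eqP; rewrite eq_le; apply/andP; split.
  rewrite (le_trans (quot_fnorm_le hp (po_graph_closed hp _ hj) _))//.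
  by rewrite fnorm_dsum/= fnorm0// addr0.
apply/ler_addgt0Pr => e e0.
have [[y' z'] yy' lt] :=
  quot_fnorm_lift hp (cW := po_graph_closed hp (bop_id X) hj)
    (po_in hp (bop_id X) hj y) e0.
rewrite (le_trans _ (ltW lt))// fnorm_dsum/=.
have [x [Tx jx]] := (po_pi_eq _ _ _ _ _ _ _).1 yy'.
have -> : y = y' - x by rewrite [x]Tx opprB addrC subrK.
rewrite [_ `^ p](_ : _ = fnorm (y' - x))// (le_trans (fnormD _ _))//.
rewrite fnormN lerD//.
have -> : z' = - j x by rewrite jx sub0r opprK.
by rewrite fnormN ler_powp ?pnorm_ge0.
Qed.

(** If [c] bounds the embedding from below, rescaling the norms of the sub-extension by the inverse
    of [c] makes the embedding norm-nondecreasing; the push-out along the identity then makes it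
    isometric. *)
Lemma isometric_representative n E X (Z : yext n E X) :
  exists2 Z', ext_equiv Z Z' & forall x, pnorm (ext_in Z' x) = pnorm x.
Proof.
have [[c c0 hc] _] := ext_in_into Z.
have c0' : 0 < c^-1 by rewrite invr_gt0.
exists (pushout_ext hp (bop_id X) (sub_ext hp Z c0')).
  apply: rst_trans (rst_sym _ _ _ _ _) _.
    exact/rst_step/(sub_ext_mor hp Z c0').
  exact/rst_step/pushout_id_mor.
apply: po_in_id_isometric => x; rewrite pnorm_sub ler_pdivlMl//; exact: hc.
Qed.

Lemma bop_norm_isometric X V (j : bop X V) : (exists x : X, x <> 0) ->
  (forall x, pnorm (j x) = pnorm x) -> bop_norm j = 1.
Proof.
move=> [x x0] jx.
have nx : pnorm x != 0 by apply/eqP => /pnorm_eq0.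
have s1 : [set pnorm (j x) | x in [set x | pnorm x <= 1]] 1.
  have e : pnorm ((pnorm x)^-1 *: x) = 1.
    by rewrite pnormZ ger0_norm ?mulVf// invr_ge0 pnorm_ge0.
  by exists ((pnorm x)^-1 *: x) => /=; rewrite ?jx e.
have ub : ubound [set pnorm (j x) | x in [set x | pnorm x <= 1]] 1.
  by move=> _ [y y1 <-]; rewrite jx.
apply/eqP; rewrite eq_le; apply/andP; split.
  by apply: ge_sup => //; exists 1.
by apply: ub_le_sup => //; exists 1.
Qed.

Lemma ext_class_surj n E X (a : Ext n E X) : exists Z, ext_class Z = a.
Proof.
case: a => P hP; have [Z e] := hP; exists Z; move: hP; rewrite e => hP.
by congr ExtClass; exact: Prop_irrelevance.
Qed.

(** One isometric representative is chosen in each class. Its code determines the class, so the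
    codes that occur can index the classes. *)
Lemma representatives_exist n E X :
  exists (A : choiceType) (rep : A -> yext n E X),
    representatives rep /\ uniformly_into rep.
Proof.
have repE (a : Ext n E X) : exists Z : yext n E X,
    ext_class Z = a /\ forall x, pnorm (ext_in Z x) = pnorm x.
  have [Z <-] := ext_class_surj a.
  have [Z' ZZ' iso] := isometric_representative Z.
  by exists Z'; split=> //; apply/ext_classP/rst_sym.
pose r a := projT1 (cid (repE a)).
have rK a : ext_class (r a) = a := (projT2 (cid (repE a))).1.
have riso a : forall x, pnorm (ext_in (r a) x) = pnorm x :=
  (projT2 (cid (repE a))).2.
pose S : Type := ((nat -> term R E X -> R) * (term R E X -> E))%type.
(* A subtype of the codes stays in a small universe, unlike [Ext n E X]. *)
pose A : Type := {s : S | exists a, ext_code (r a) = s}.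
pose cl (s : A) : Ext n E X := projT1 (cid (projT2 s)).
have clE s : ext_code (r (cl s)) = projT1 s := projT2 (cid (projT2 s)).
have Ainj (s s' : A) : projT1 s = projT1 s' -> s = s'.
  case: s s' => s hs [s' hs'] /= e; move: hs; rewrite e => hs.
  by congr exist; exact: Prop_irrelevance.
exists {classic A}, (fun s => r (cl s)); split; last first.
  by exists 1 => // s x; rewrite mul1r riso.
split; last by move=> x0 s; apply: bop_norm_isometric.
exists (fun a => exist _ (ext_code (r a)) (ex_intro _ a erefl)).
  by move=> s; apply: Ainj; rewrite rK /= clE.
move=> a; rewrite rK -[RHS]rK -[LHS]rK; apply/ext_classP/(ext_equiv_code hp).
by rewrite clE.
Qed.

End PushoutMorphisms.

(** * Splitting of push-outs along operators that extend *)

Section Vanishing.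
Context {R : realType} {p : R} (hp : 0 < p <= 1).

(** As [tau] extends [T], the map sending [(y, z)] to [y + tau z] is a retraction of the push-out
    onto [Y]. Together with [ext_out] in the last degree it gives a morphism to the zero
    extension. *)
Lemma pushout_ext_zero n (hn : (0 < n)%N) (E X Y : pBanach p)
    (Z : yext n E X) (T : bop X Y) (tau : bop (ext_obj Z 1) Y) :
    (forall x, T x = tau (ext_in Z x)) ->
  ext_mor (pushout_ext hp T Z) (zero_ext hp E Y hn).
Proof.
case: n hn Z tau => [//|[|m]] hn Z tau TE.
  have [|h hE] := po_factor hp (ext_in_into Z) (T := T) (f := bop_inl hp Y E)
    (g := bop_add hp (bop_comp (bop_inl hp Y E) tau)
                     (bop_comp (bop_inr hp Y E) (ext_out Z))).
    move=> x; rewrite /= -TE ext_out_in//.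
    by congr pair => /=; rewrite addr0.
  pose f i : bop (po_ext_obj hp T Z i) (dsum hp Y E) :=
    match i return bop (po_ext_obj hp T Z i) (dsum hp Y E) with
    | 1 => h | _ => bop_zero _ _
    end.
  exists f; split=> [y|[|[]]//|z].
    by rewrite /= hE !linear0 /= addr0.
  have [y [w <-]] := po_surj z; rewrite /= hE po_descE; last exact: ext_out_in.
  by rewrite /= !add0r.
have [|h hE] :=
    po_factor hp (ext_in_into Z) (T := T) (f := bop_id Y) (g := tau).
  exact: TE.
pose O := zero_ext_obj m E Y.
pose f0 i : bop (po_ext_obj hp T Z i) (O i) :=
  match i return bop (po_ext_obj hp T Z i) (O i) with
  | 1 => h | _ => bop_zero _ _
  end.
(* The last space of the zero extension becomes [E] only once the test [m < m] is decided; [g] is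
   [ext_out] up to this identification. *)
have [g gE] : exists g : bop (ext_obj Z m.+2) (O m.+2),
    (forall z, zero_ext_out m E Y (g z) = ext_out Z z) /\
    forall z, ext_out Z z = 0 -> g z = 0.
  rewrite /O /zero_ext_out /=; move: (ltnn m); case: (m < m)%N => // _.
  by exists (ext_out Z).
pose f := dfwith f0 m.+2 g.
have f1 : f 1%N = h by rewrite /f dfwithout.
have fn : f m.+2 = g by exact: dfwithin.
exists f; split.
- by move=> y; rewrite f1 [LHS]hE linear0 addr0.
- move=> i /andP[i0 im] z.
  have -> : forall y, ext_d (zero_ext hp E Y hn) i y = 0 by [].
  (* At the last differential, commutation holds because [ext_out] kills its range; at the others
     the map of degree [i.+1] is zero. *)
  case: (eqVneq i m.+1) => [e|ne].
    move: e z => {i0 im} -> z; rewrite fn; apply: gE.2.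
    exact: (ext_out_d hp (Z := pushout_ext hp T Z)).
  case: i i0 im ne z => [//|i] _ _ ne z.
  by rewrite /f dfwithout//; rewrite eq_sym.
- by move=> z; rewrite fn; exact: gE.1.
Qed.

End Vanishing.

(** * Closures of subspaces *)

Section Approximation.
Context {R : realType} {p : R} (hp : 0 < p <= 1).

(** The set is the closure of [D]. It turns membership in a closed span into approximation by
    elements of [D]. *)
Lemma approx_closed_subspace (V : pBanach p) (D : set V) : Defs.subspace D ->
  closed_subspace [set w | forall e : R, 0 < e ->
    exists2 w', D w' & fnorm (w - w') < e].
Proof.
move=> [D0 DL]; split; first split.
- by move=> e e0; exists 0 => //; rewrite subrr fnorm0.
(* Adding 1 makes [k] positive, so that dividing by it is harmless when [a = 0]. *)
- move=> a x y hx hy e e0; pose k := `|a| `^ p + 1.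
  have k0 : 0 < k by rewrite ltr_wpDl// powR_ge0.
  have [|x' Dx' xx'] := hx (e / 2 / k); first by rewrite !divr_gt0.
  have [|y' Dy' yy'] := hy (e / 2); first by rewrite divr_gt0.
  exists (a *: x' + y'); first exact: DL.
  rewrite opprD addrACA -scalerBr (le_lt_trans (fnormD _ _))//.
  rewrite [ltRHS]splitr ler_ltD// fnormZ (@le_trans _ _ (k * fnorm (x - x')))//.
    by rewrite ler_wpM2r ?fnorm_ge0// lerDl.
  by rewrite mulrC -ler_pdivlMr// ltW.
move=> u l hu /(nrm_cvg_fnorm hp) ul e e0.
have e2 : 0 < e / 2 by rewrite divr_gt0.
have [N hN] := ul _ e2; have [w Dw uw] := hu N _ e2.
exists w => //; rewrite (le_lt_trans (ler_fnormB _ (u N) _))// [ltRHS]splitr.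
by rewrite ltrD// fnorm_distC hN.
Qed.

End Approximation.

(** * Coordinate embeddings into the p-sum *)

Section Coordinates.
Context {R : realType} {p : R} (hp : 0 < p <= 1) {I : choiceType}.
Variables (X : I -> pBanach p) (a : I).

Definition single_fun (z : X a) : dprod X := dfwith (fun i => 0 : X i) a z.

Lemma single_in z : single_fun z a = z.
Proof. exact: dfwithin. Qed.

Lemma single_out z b : b <> a -> single_fun z b = 0.
Proof. by move=> ba; rewrite /single_fun dfwithout//; apply/eqP => /esym. Qed.

Lemma single_sum_le z (s : seq I) : uniq s ->
  \sum_(i <- s) fnorm (single_fun z i) <= fnorm z.
Proof.
move=> us.
have s0 i : i != a -> fnorm (single_fun z i) = 0.
  by move=> /eqP ia; rewrite single_out// fnorm0.
have [sa|sa] := boolP (a \in s).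
  by rewrite (bigD1_seq a)//= single_in big1 ?addr0.
rewrite big_seq big1 ?fnorm_ge0// => i si; rewrite s0//.
by apply: contraNneq sa => <-.
Qed.

Fact single_lp z : lp_pred hp (single_fun z).
Proof.
apply/asboolP; apply: (@le_lt_trans _ _ (fnorm z)%:E); last exact: ltry.
apply: ge_ereal_sup => _ [A [finA _] <-].
by rewrite fsbig_finite//= sumEFin lee_fin single_sum_le.
Qed.

Definition single (z : X a) : lp_sum hp X := LpType (single_lp z).

Fact single_linear : linear single.
Proof.
move=> c x y; apply: val_inj; apply: functional_extensionality_dep => i.
change (single_fun (c *: x + y) i = c *: single_fun x i + single_fun y i).
have [->|/eqP ia] := eqVneq i a; first by rewrite !single_in.
by rewrite !single_out// scaler0 addr0.
Qed.

Fact single_bounded : exists C : R, forall z, pnorm (single z) <= C * pnorm z.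
Proof.
apply: (bop_of_fnorm_bounded hp); exists 1 => z; rewrite mul1r.
by apply: lp_powp_le => s us; exact: single_sum_le.
Qed.

Definition bop_single : bop (X a) (lp_sum hp X) :=
  bop_of single_linear single_bounded.

End Coordinates.

(** * The canonical operators into [N_space] and their lower bound *)

Section CanonicalEmbedding.
Context {R : realType} {p : R} (hp : 0 < p <= 1).
Variables (n : nat) (E X : pBanach p) (A : choiceType) (rep : A -> yext n E X).
Local Notation Zs := (fun a => ext_obj (rep a) 1).
Local Notation N := (N_space hp rep).
Local Notation inj a := (@bop_single _ _ hp _ Zs a).
Local Notation sgl a := (@single_fun _ _ _ Zs a).

Definition N_in a : bop (ext_obj (rep a) 1) N :=
  bop_comp (bop_pi hp (closed_span_closed _)) (inj a).

(** For distinct indices, the two lifts to the p-sum differ by a cross element. *)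
Lemma N_in_ext_in a a' x :
  N_in a (ext_in (rep a) x) = N_in a' (ext_in (rep a') x).
Proof.
have [->//|/eqP aa'] := eqVneq a a'.
apply/quot_pi_eq; apply: closed_span_sub; rewrite /cross_elements /=.
exists x, a, a'; split=> //.
- change (sgl a (ext_in (rep a) x) a - sgl a' (ext_in (rep a') x) a =
    ext_in (rep a) x :> Zs a).
  by rewrite single_in single_out// subr0.
- change (sgl a (ext_in (rep a) x) a' - sgl a' (ext_in (rep a') x) a' =
    - ext_in (rep a') x :> Zs a').
  by rewrite single_in single_out ?sub0r// => /esym.
- move=> b ba ba'.
  change (sgl a (ext_in (rep a) x) b - sgl a' (ext_in (rep a') x) b =
    0 :> Zs b).
  by rewrite !single_out// subr0.
Qed.

(* The condition on t makes x finitely supported, with sum 0, without having to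
   merge supports when families are added. *)
Definition balanced : set (Z1_sum hp rep) :=
  [set w | exists (x : A -> X) (s : seq A),
    (forall b, lp_val w b = ext_in (rep b) (x b)) /\
    forall t, uniq t -> {subset s <= t} -> \sum_(b <- t) x b = 0].

Lemma balanced_subspace : Defs.subspace balanced.
Proof.
split=> [|c w w' [x [s [wx xs]]] [x' [s' [wx' xs']]]].
  by exists (fun=> 0), [::]; split=> [b|t _ _]; rewrite ?linear0// big1.
exists (fun b => c *: x b + x' b), (s ++ s'); split=> [b|t ut st].
  change (c *: lp_val w b + lp_val w' b = ext_in (rep b) (c *: x b + x' b)).
  by rewrite linearP wx wx'.
rewrite big_split -scaler_sumr/= xs ?xs' ?scaler0 ?addr0//.
  by move=> b bs; rewrite st// mem_cat bs orbT.
by move=> b bs; rewrite st// mem_cat bs.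
Qed.

Lemma cross_balanced (w : Z1_sum hp rep) : cross_elements w -> balanced w.
Proof.
move=> [x [a [a' [aa' wa wa' w0]]]].
exists (fun b => if b == a then x else if b == a' then - x else 0), [:: a; a'].
have a'a : (a' == a) = false by apply/eqP => /esym.
split=> [b|t ut st].
  have [->//|/eqP ba] := eqVneq b a.
  have [->|/eqP ba'] := eqVneq b a'; first by rewrite wa' linearN.
  by rewrite w0// linear0.
have ta : a \in t by rewrite st// mem_head.
have ta' : a' \in t by rewrite st// !inE eqxx orbT.
rewrite (bigD1_seq a)//= eqxx -big_filter (bigD1_seq a')/=; last first.
- exact: filter_uniq.
- by rewrite mem_filter a'a.
rewrite a'a eqxx big_filter_cond big1 ?addr0 ?subrr// => b.
by move=> /andP[/negPf -> /negPf ->].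
Qed.

(** The coordinates of the sum are images of vectors [y' b] of [X] that add up to [x]. The triangle
    inequality for [fnorm] on [X] and the lower bound for each embedding give the estimate. *)
Lemma balanced_fnorm_ge c :
    (forall a x, c * fnorm x <= fnorm (ext_in (rep a) x)) -> 0 < c ->
  forall a x w, balanced w ->
    c * fnorm x <= fnorm (inj a (ext_in (rep a) x) + w).
Proof.
move=> hc c0 a x w [y [s [wy ys]]].
(* A single list containing [a] and the support of [y], over which [y] still sums to 0. *)
pose t := undup (a :: s).
have ut : uniq t by exact: undup_uniq.
have ta : a \in t by rewrite mem_undup mem_head.
pose y' b := (if b == a then x else 0) + y b.
have vE b : lp_val (inj a (ext_in (rep a) x) + w) b = ext_in (rep b) (y' b).
  change (sgl a (ext_in (rep a) x) b + lp_val w b = ext_in (rep b) (y' b)).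
  rewrite wy linearD /=; have [->|/eqP ba] := eqVneq b a.
    by rewrite single_in.
  by rewrite single_out// linear0.
have sy' : \sum_(b <- t) y' b = x.
  rewrite big_split/= ys// ?addr0.
    by rewrite (bigD1_seq a)//= eqxx big1 ?addr0// => b /negPf ->.
  by move=> b bs; rewrite mem_undup inE bs orbT.
rewrite (le_trans _ (lp_powp_ge _ ut))//.
rewrite -[in leLHS]sy' (@le_trans _ _ (\sum_(b <- t) c * fnorm (y' b)))//.
  rewrite -mulr_sumr ler_pM2l//.
  elim/big_ind2 : _ => [|u v u' v' uv uv'|//]; first by rewrite fnorm0.
  by rewrite (le_trans (fnormD _ _))// lerD.
by apply: ler_sum => b _; rewrite vE.
Qed.

(** A lift [v] of almost minimal norm differs from the image of [x] in the p-sum by an element of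
    the closed span, which is approximated by a balanced [w]. Each approximation costs [e / 2]. *)
Lemma N_in_ext_in_ge c :
    (forall a x, c * fnorm x <= fnorm (ext_in (rep a) x)) -> 0 < c ->
  forall a x, c * fnorm x <= fnorm (N_in a (ext_in (rep a) x)).
Proof.
move=> hc c0 a x; apply/ler_addgt0Pr => e e0.
have e2 : 0 < e / 2 by rewrite divr_gt0.
have [v va vlt] := quot_fnorm_lift hp
  (cW := closed_span_closed (@cross_elements _ _ hp _ _ _ _ rep))
  (N_in a (ext_in (rep a) x)) e2.
have /quot_pi_eq vW := va.
(* The closed span is the smallest closed subspace containing the cross elements, so it lies in the
   closure of the balanced families. *)
have [] := vW [set w | forall e : R, 0 < e ->
    exists2 w', balanced w' & fnorm (w - w') < e] _ _ e2.
  split; first exact/(approx_closed_subspace hp)/balanced_subspace.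
  move=> w /cross_balanced bw e' e'0.
  by exists w => //; rewrite subrr fnorm0.
move=> w bw ww.
rewrite (le_trans (balanced_fnorm_ge hc c0 a x bw))//.
move: (inj a _) ww => s ww.
have -> : s + w = v - (v - s - w).
  by rewrite opprB opprB addrCA [v + _]addrC subrK addrC.
rewrite [e]splitr addrA (le_trans (fnormD _ _))// fnormN.
by rewrite lerD// ltW.
Qed.

End CanonicalEmbedding.

Theorem theorem3p2 (R : realType) (p : R) (hp : 0 < p <= 1) (n : nat)
    (hn : (1 <= n)%N) (E X : pBanach p) :
  (exists (A : choiceType) (rep : A -> yext n E X),
     representatives rep /\ uniformly_into rep) /\
  (forall (A : choiceType) (rep : A -> yext n E X),
     representatives rep -> uniformly_into rep ->
     exists rho : bop X (N_space hp rep),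
       into_isomorphism rho /\
       forall Z : yext n E X,
         ext_class (pushout_ext hp rho Z) = Ext_zero hp hn E (N_space hp rep)).
Proof.
split=> [|A rep [[cl clK Kcl] _] [c c0 hc]]; first exact: representatives_exist.
(* The zero class supplies an index; by [N_in_ext_in] any other gives the same operator. *)
pose a0 := cl (Ext_zero hp hn E X).
exists (bop_comp (N_in hp rep a0) (ext_in (rep a0))); split.
  apply/(into_isomorphismP hp); exists (c `^ p); first exact: powR_gt0.
  apply: N_in_ext_in_ge; last exact: powR_gt0.
  move=> a x; rewrite -powRM ?pnorm_ge0 ?(ltW c0)//.
  by rewrite ler_powp ?mulr_ge0 ?pnorm_ge0 ?(ltW c0).
(* [Z] may be replaced by the representative of its class, to whose first space [N_in] extends the
   operator. *)
move=> Z; have /ext_classP eZ := Kcl (ext_class Z).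
apply/ext_classP; apply: rst_trans.
  exact: (rst_sym _ _ _ _ (pushout_ext_equiv hp _ eZ)).
apply: rst_step; apply: (pushout_ext_zero hp hn (tau := N_in hp rep _)) => x.
exact: N_in_ext_in.
Qed.
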